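(* Let $\alpha, \zeta \in T$ have infinite order. Then there exists $\gamma \in T$ such that $T = \langle \alpha, \zeta^\gamma \rangle$.
   Context: Let $\mathbb{S}^1 = \mathbb{R}/\mathbb{Z}$. Thompson's group $T$ is the group (under composition) of piecewise linear homeomorphisms of $\mathbb{S}^1$ which preserve $\mathbb{Z}[\frac12]/\mathbb{Z}$ (the image of the dyadic rationals), have finitely many breakpoints, have all gradients equal to integral powers of two (in particular gradients are positive), and have all breakpoints in $\mathbb{Z}[\frac12]/\mathbb{Z}$. Group actions are on the right, products are read from left to right, and $x^y = y^{-1}xy$. $\langle \alpha, \beta\rangle$ denotes the subgroup generated by $\alpha$ and $\beta$. *)

(* Defs.v *)
From HB Require Import structures.
From mathcomp Require Import all_boot all_order all_algebra generic_quotient.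
From mathcomp Require Import all_classical all_reals all_analysis.
Set Implicit Arguments.
Unset Strict Implicit.
Unset Printing Implicit Defensive.
Import Order.TTheory GRing.Theory Num.Theory.
Import numFieldNormedType.Exports.
Local Open Scope classical_set_scope.
Local Open Scope ring_scope.

Section Homeo.
Variable X : topologicalType.

Record homeo := Homeo {
  homeo_fun :> X -> X;
  homeo_inv : X -> X;
  homeoK : cancel homeo_fun homeo_inv;
  homeoVK : cancel homeo_inv homeo_fun;
  homeo_cont : continuous homeo_fun;
  homeo_invcont : continuous homeo_inv }.

Lemma homeoP (f g : homeo) : homeo_fun f = homeo_fun g -> f = g.
Proof.
case: f g => [f f' fK f'K fc f'c] [g g' gK g'K gc g'c] /= efg; subst g.
have e : f' = g' by apply/funext => x; rewrite -{1}[x]g'K fK.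
by subst g'; congr Homeo; exact: Prop_irrelevance.
Qed.

HB.instance Definition _ := gen_eqMixin homeo.
HB.instance Definition _ := gen_choiceMixin homeo.

Definition homeo1 : homeo :=
  @Homeo id id (fun=> erefl) (fun=> erefl) (fun=> cvg_id) (fun=> cvg_id).

Definition homeoV (f : homeo) : homeo :=
  @Homeo (homeo_inv f) f (@homeoVK f) (@homeoK f)
    (@homeo_invcont f) (@homeo_cont f).

(* Maps act on the right: the product f * g applies f first. *)
Definition homeoM (f g : homeo) : homeo :=
  @Homeo (g \o f) (homeo_inv f \o homeo_inv g)
    (can_comp (@homeoK g) (@homeoK f)) (can_comp (@homeoVK f) (@homeoVK g))
    (fun x => continuous_comp (@homeo_cont f x) (@homeo_cont g (f x)))
    (fun x => continuous_comp (@homeo_invcont g x)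
                (@homeo_invcont f (homeo_inv g x))).

Lemma homeoMA : associative homeoM.
Proof. by move=> f g h; exact: homeoP. Qed.
Lemma homeo1M : left_id homeo1 homeoM.
Proof. by move=> f; exact: homeoP. Qed.
Lemma homeoM1 : right_id homeo1 homeoM.
Proof. by move=> f; exact: homeoP. Qed.
Lemma homeoMV : left_inverse homeo1 homeoV homeoM.
Proof. by move=> f; apply/homeoP/funext => x /=; exact: homeoVK. Qed.
Lemma homeoVM : right_inverse homeo1 homeoV homeoM.
Proof. by move=> f; apply/homeoP/funext => x /=; exact: homeoK. Qed.

HB.instance Definition _ :=
  isGroup.Build homeo homeoMA homeo1M homeoM1 homeoMV homeoVM.

End Homeo.

Section GroupNotions.
Local Open Scope group_scope.
Variable G : groupType.

Definition is_subgroup (H : set G) : Prop :=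
  [/\ H 1, forall x y, H x -> H y -> H (x * y) & forall x, H x -> H x^-1].

Definition generated (A : set G) : set G := smallest is_subgroup A.

Definition infinite_order (x : G) : Prop :=
  forall n : nat, (0 < n)%N -> x ^+ n <> 1.

End GroupNotions.

Section Circle.
Local Open Scope quotient_scope.
Variable R : realType.

Definition eq_mod1 (x y : R) : bool := (x - y) \is a Num.int.

Lemma eq_mod1_refl : reflexive eq_mod1.
Proof. by move=> x; rewrite /eq_mod1 subrr rpred0. Qed.
Lemma eq_mod1_sym : symmetric eq_mod1.
Proof. by move=> x y; rewrite /eq_mod1 -rpredN opprB. Qed.
Lemma eq_mod1_trans : transitive eq_mod1.
Proof.
move=> y x z xy yz; rewrite /eq_mod1 -(subrKA y x (- z)); exact: rpredD.
Qed.
Canonical eq_mod1_equiv :=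
  EquivRel eq_mod1 eq_mod1_refl eq_mod1_sym eq_mod1_trans.

Definition circle : topologicalType :=
  quotient_topology {eq_quot eq_mod1_equiv}.

Definition toCircle (x : R) : circle := \pi_({eq_quot eq_mod1_equiv}) x.

Definition dyadic : set R :=
  [set x | exists (m : int) (n : nat), x = m%:~R / 2 ^+ n].

Definition dyadic_circle : set circle := toCircle @` dyadic.

Definition affine_at (f : circle -> circle) (a : R) (p : circle) : Prop :=
  exists x c : R, toCircle x = p /\
    \forall y \near x, f (toCircle y) = toCircle (a * y + c).

Definition breakpoints (f : circle -> circle) : set circle :=
  [set p | forall a, ~ affine_at f a p].

(* A homeomorphism of the circle with finitely many breakpoints is
   automatically piecewise linear. *)
Definition thompsonT : set (homeo circle) :=
  [set f | [/\ f @` dyadic_circle = dyadic_circle,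
               finite_set (breakpoints f),
               breakpoints f `<=` dyadic_circle
             & forall (a : R) (p : circle),
                 affine_at f a p -> exists k : int, a = 2 ^ k]].

Lemma toCircleP (x y : R) : toCircle x = toCircle y <-> x - y \is a Num.int.
Proof.
by have r := @eqmodP _ eq_mod1_equiv x y; split=> h; apply/r.
Qed.

Lemma toCircle_surj (p : circle) : exists x, toCircle x = p.
Proof. by exists (repr p); exact: reprK. Qed.

Lemma affine_atE f a p x : affine_at f a p -> toCircle x = p ->
  exists c, \forall y \near x, f (toCircle y) = toCircle (a * y + c).
Proof.
move=> [x0 [c [<- h]]] /toCircleP xx0.
exists (c - a * (x - x0)).
have : \forall y \near x, f (toCircle (y - (x - x0)))
    = toCircle (a * (y - (x - x0)) + c).
  have cv : (fun y : R => y - (x - x0)) @ x --> x0.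
    rewrite -[X in _ --> X](subKr x x0).
    by apply: cvgB; [exact: cvg_id|exact: cvg_cst].
  exact: cv _ h.
apply: filterS => y.
have -> : toCircle (y - (x - x0)) = toCircle y.
  by apply/toCircleP; rewrite addrC addKr rpredN.
by move=> ->; congr toCircle; rewrite mulrBr addrAC -addrA.
Qed.

Lemma affine_at_comp (f g : circle -> circle) a b p :
  affine_at f a p -> affine_at g b (f p) -> affine_at (g \o f) (b * a) p.
Proof.
move=> [x [c [xp h]]] hg.
have fx : toCircle (a * x + c) = f p by rewrite -(nbhs_singleton h) xp.
have [c' h'] := affine_atE hg fx.
exists x, (b * c + c'); split=> //=.
have cv : (fun y : R => a * y + c) @ x --> a * x + c.
  by apply: cvgD; [apply: cvgM; [exact: cvg_cst|exact: cvg_id]|exact: cvg_cst].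
have := cv _ h'; rewrite /= => h2.
near=> y.
have -> : f (toCircle y) = toCircle (a * y + c) by near: y.
have -> : g (toCircle (a * y + c)) = toCircle (b * (a * y + c) + c').
  by near: y.
by rewrite mulrDr mulrA addrA.
Unshelve. all: by end_near. Qed.

Lemma affine_at_inv (f : homeo circle) a p : a != 0 ->
  affine_at f a p -> affine_at (homeo_inv f) a^-1 (f p).
Proof.
move=> a0 [x [c [xp h]]].
exists (a * x + c), (- (a^-1 * c)); split; first by rewrite -(nbhs_singleton h) xp.
have cv : (fun z : R => a^-1 * z - a^-1 * c) @ (a * x + c) --> x.
  rewrite -[X in _ --> X](mulKf a0) -[X in _ --> X](addrK (a^-1 * c)) -mulrDr.
  by apply: cvgB; [apply: cvgM; [exact: cvg_cst|exact: cvg_id]|exact: cvg_cst].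
have : \forall z \near (a * x + c), f (toCircle (a^-1 * z - a^-1 * c))
    = toCircle (a * (a^-1 * z - a^-1 * c) + c) by exact: cv _ h.
apply: filterS => z /= e.
rewrite mulrBr !mulVKf// subrK in e.
by rewrite -e homeoK.
Qed.

Lemma int_lt1_eq0 (x : R) : x \is a Num.int -> `|x| < 1 -> x = 0.
Proof.
move=> /intrP[k ->]; rewrite -intr_norm ltrz1 -abszE ltz_nat ltnS leqn0.
by rewrite absz_eq0 => /eqP ->.
Qed.

Lemma avoid_finite (F : set circle) (P : R -> Prop) (x : R) :
  finite_set F -> (\forall y \near x, P y) ->
  exists y, ~ F (toCircle y) /\ P y.
Proof.
move=> finF /nbhs_ballP [e /= e0 eP].
apply: contrapT => nex.
pose d := Num.min e 1; pose u (n : nat) := x + d / n.+2%:R.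
have d0 : 0 < d by rewrite lt_min e0 ltr01.
have un n : 0 < d / n.+2%:R < d.
  by rewrite divr_gt0//= ltr_pdivrMr// ltr_pMr// ltr1n.
have uP n : F (toCircle (u n)).
  apply: contrapT => nF; apply: nex; exists (u n); split=> //; apply: eP.
  have /andP[u0 ud] := un n.
  rewrite /ball/= opprD addNKr normrN gtr0_norm//.
  by rewrite (lt_le_trans ud)// ge_min lexx.
have inj : injective (toCircle \o u).
  move=> m n /= /toCircleP; rewrite /u opprD addrACA subrr add0r => hi.
  have /andP[m0 md] := un m; have /andP[n0 nd] := un n.
  have d1 : d <= 1 by rewrite ge_min lexx orbT.
  have small : `|d / m.+2%:R - d / n.+2%:R| < 1.
    rewrite ltr_norml; apply/andP; split.
      rewrite ltrBrDl (lt_le_trans _ (ltW m0))// subr_lt0.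
      exact: lt_le_trans nd d1.
    by rewrite ltrBlDr (lt_le_trans (lt_le_trans md d1))// lerDl ltW.
  move/eqP: (int_lt1_eq0 hi small); rewrite subr_eq0 => /eqP /(mulfI (lt0r_neq0 d0)) /invr_inj /eqP.
  by rewrite eqr_nat => /eqP [].
have : finite_set [set: nat].
  by apply: sub_finite_set (finite_preimage (in2W inj) finF) => n _; exact: uP.
exact: infinite_nat.
Qed.

Lemma affine_at_uniq f a b p : affine_at f a p -> affine_at f b p -> a = b.
Proof.
move=> [x [c [xp h]]] /affine_atE /(_ xp) [c' h'].
apply: contrapT => /eqP; rewrite -subr_eq0 => ab.
have : \forall y \near x, (a - b) * y + (c - c') \is a Num.int.
  near=> y.
  have e1 : f (toCircle y) = toCircle (a * y + c) by near: y.
  have e2 : f (toCircle y) = toCircle (b * y + c') by near: y.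
  have /toCircleP : toCircle (a * y + c) = toCircle (b * y + c').
    by rewrite -e1 -e2.
  by rewrite mulrBl opprD addrACA.
move=> /nbhs_ballP [e /= e0 eP].
pose d := Num.min (e / 2) (`|a - b|^-1 / 2).
have nab : 0 < `|a - b| by rewrite normr_gt0.
have d0 : 0 < d by rewrite lt_min !divr_gt0// invr_gt0.
have i0 := eP x (ballxx _ e0).
have i1 : (a - b) * (x + d) + (c - c') \is a Num.int.
  apply: eP; rewrite /ball/= opprD addNKr normrN gtr0_norm//.
  by rewrite gt_min ltr_pdivrMr// ltr_pMr// ltr1n.
have : (a - b) * d \is a Num.int.
  have := rpredB i1 i0.
  by rewrite opprD addrACA subrr addr0 mulrDr addrAC subrr add0r.
move=> ik.
have : `|(a - b) * d| < 1.
  rewrite normrM (gtr0_norm d0) -ltr_pdivlMl// mulr1 gt_min.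
  by rewrite [X in _ || X]ltr_pdivrMr// ltr_pMr ?ltr1n ?orbT// invr_gt0.
have : (a - b) * d != 0 by rewrite mulf_neq0// gt_eqF.
by move=> /eqP nz /(int_lt1_eq0 ik).
Unshelve. all: by end_near. Qed.

Lemma affine_at_near f a x : affine_at f a (toCircle x) ->
  \forall y \near x, affine_at f a (toCircle y).
Proof.
move=> /affine_atE /(_ erefl) [c hc].
have : \forall y \near x, \forall z \near y,
    f (toCircle z) = toCircle (a * z + c) by exact: (nbhs_interior hc).
by apply: filterS => y hy; exists y, c; split.
Qed.

Lemma nbreakpoint f p : ~ breakpoints f p -> exists a, affine_at f a p.
Proof.
by move=> h; apply: contrapT => ne; apply: h => a ha; apply: ne; exists a.
Qed.

Lemma thompsonT_subgroup : is_subgroup thompsonT.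
Proof.
split.
- have id1 (p : circle) : affine_at id 1 p.
    have [x xp] := toCircle_surj p; exists x, 0; split=> //.
    by apply: filterE => y; rewrite mul1r addr0.
  have nb : breakpoints (homeo_fun (1%g : homeo circle)) = set0.
    by apply/seteqP; split=> // p /(_ 1); apply; exact: id1.
  split; [exact: image_id|by rewrite nb|by rewrite nb|].
  by move=> a p /affine_at_uniq /(_ (id1 p)) ->; exists 0.
- move=> f g [fD fF fB fS] [gD gF gB gS].
  have bp : breakpoints (f * g)%g `<=`
      breakpoints f `|` homeo_inv f @` breakpoints g.
    move=> p hp; apply: contrapT => /not_orP[/nbreakpoint[a ha] nb].
    have /nbreakpoint[b hb] : ~ breakpoints g (f p).
      by move=> h; apply: nb; exists (f p) => //; exact: homeoK.
    by apply: (hp (b * a)); exact: affine_at_comp.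
  have finU : finite_set (breakpoints f `|` homeo_inv f @` breakpoints g).
    by rewrite finite_setU; split=> //; exact: finite_image.
  split.
  + by rewrite -[RHS]gD -[in RHS]fD image_comp.
  + exact: sub_finite_set bp finU.
  + move=> p /bp [/fB//|[q /gB]]; rewrite -{1}fD => -[r rD <-] <-.
    by rewrite homeoK.
  + move=> a p; have [x <-] := toCircle_surj p => /affine_at_near ha.
    have [y [/not_orP[/nbreakpoint[b hb] nb] hy]] := avoid_finite finU ha.
    have /nbreakpoint[b' hb'] : ~ breakpoints g (f (toCircle y)).
      by move=> h; apply: nb; exists (f (toCircle y)) => //; exact: homeoK.
    have -> : a = b' * b.
      by apply: (affine_at_uniq hy); exact: affine_at_comp.
    have [k ->] := fS _ _ hb; have [l ->] := gS _ _ hb'.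
    by exists (l + k); rewrite expfzDr.
- move=> f [fD fF fB fS].
  have nz a p : affine_at f a p -> a != 0.
    by move=> /fS[k ->]; rewrite expfz_neq0.
  have bp : breakpoints (f^-1)%g `<=` f @` breakpoints f.
    move=> p hp; apply: contrapT => nb.
    have /nbreakpoint[a ha] : ~ breakpoints f (homeo_inv f p).
      by move=> h; apply: nb; exists (homeo_inv f p) => //; exact: homeoVK.
    apply: (hp a^-1); have := affine_at_inv (nz _ _ ha) ha.
    by rewrite homeoVK.
  have finU : finite_set (f @` breakpoints f) by exact: finite_image.
  split.
  + rewrite -{1}fD image_comp (_ : _ \o _ = id) ?image_id//.
    by apply/funext => p /=; exact: (@homeoK _ f).
  + exact: sub_finite_set bp finU.
  + by move=> p /bp [q /fB qD <-]; rewrite -fD; exists q.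
  + move=> a p; have [x <-] := toCircle_surj p => /affine_at_near ha.
    have [y [nb hy]] := avoid_finite finU ha.
    have /nbreakpoint[b hb] : ~ breakpoints f (homeo_inv f (toCircle y)).
      by move=> h; apply: nb; exists (homeo_inv f (toCircle y)) => //;
         exact: homeoVK.
    have := affine_at_inv (nz _ _ hb) hb; rewrite homeoVK => hb'.
    rewrite (affine_at_uniq hy hb'); have [k ->] := fS _ _ hb.
    by exists (- k); rewrite invr_expz.
Qed.

End Circle.

(* Main.v *)
(** Let X be a short dyadic arc, small enough to have three disjoint translates
    X a1, X a2, X a3 by powers of alpha, in this cyclic order and disjoint from X.
    Approximating the rotation number of zeta by a rational (Dirichlet) gives a power
    b of zeta and a point z whose lifts satisfy z < z b < ... < z b^7 < z + 1.
    Choose gamma mapping [z, z b^3] onto the closure of the complement of X, and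
    three consecutive b-translates of a subarc of [z, z b] onto X a1, X a2, X a3.  The values of gamma on these three
    subarcs are still free, and are chosen such that a1 b^gamma a2^-1 and
    a2 b^gamma a3^-1 act on X as the two standard generators of Thompson's group F
    (realized on X).  So every element of F_X is the restriction to X of an element
    of H = <alpha, zeta^gamma>, and t = (b^gamma)^4 in H maps the complement of X
    into X.

    Such an H is all of T.  Correcting t by an element extending one of F_X gives
    q in H which is the identity on a subarc C of X and moves the complement of X
    into X; if f1, f2 are supported in C and h1, h2 in H extend them, then
    [f1, f2] = [h1, h2^q].  The pentagon relation x^2 = x_0 x x_1 between conjugate
    elements then puts the generators of F on every small subarc of C into H.
    Finally an arbitrary f in T agrees on some arc with an element of H, and an
    element which is the identity on an arc can be conjugated by H to be supported
    in a given subarc of C. *)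

Require Import Defs.
From mathcomp Require Import all_boot all_order all_algebra.
From mathcomp Require Import all_classical all_reals all_analysis.
From mathcomp Require Import ring lra zify.
Set Implicit Arguments.
Unset Strict Implicit.
Unset Printing Implicit Defensive.
Import Order.TTheory GRing.Theory Num.Theory.
Import numFieldNormedType.Exports.
Local Open Scope classical_set_scope.
Local Open Scope ring_scope.

(** * Dyadic numbers *)

Section Dyadic.
Variable R : realType.
Implicit Types (x y : R) (k m : int) (n : nat).

Lemma pow2_gt0 k : 0 < (2 : R) ^ k.
Proof. by rewrite exprz_gt0. Qed.

Lemma pow2_neq0 k : (2 : R) ^ k != 0.
Proof. by rewrite gt_eqF// pow2_gt0. Qed.

Lemma dyadic_int m : dyadic (m%:~R : R).
Proof. by exists m, 0%N; rewrite expr0 divr1. Qed.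

Lemma dyadic_nat n : dyadic (n%:R : R).
Proof. by exists (Posz n), 0%N; rewrite expr0 divr1. Qed.

Lemma dyadic_grid m n : dyadic (m%:~R / 2 ^+ n : R).
Proof. by exists m, n. Qed.

Lemma dyadicN x : dyadic x -> dyadic (- x).
Proof. by move=> [m [n ->]]; exists (- m), n; rewrite rmorphN mulNr. Qed.

Lemma dyadicD x y : dyadic x -> dyadic y -> dyadic (x + y).
Proof.
move=> [m [n ->]] [m' [n' ->]]; exists (m * Posz (2 ^ n')%N + m' * Posz (2 ^ n)%N), (n + n')%N.
rewrite rmorphD !rmorphM /= exprD -!pmulrn !natrX.
by field; rewrite !expf_neq0.
Qed.

Lemma dyadicB x y : dyadic x -> dyadic y -> dyadic (x - y).
Proof. by move=> dx dy; apply: dyadicD => //; exact: dyadicN. Qed.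

Lemma dyadicM x y : dyadic x -> dyadic y -> dyadic (x * y).
Proof.
move=> [m [n ->]] [m' [n' ->]]; exists (m * m'), (n + n')%N.
by rewrite rmorphM exprD invfM mulrACA.
Qed.

Lemma dyadic_exp k : dyadic ((2 : R) ^ k).
Proof.
case: k => n.
  by exists (Posz (2 ^ n)%N), 0%N; rewrite expr0 divr1 -pmulrn natrX.
by exists 1, n.+1; rewrite NegzE mul1r exprnN.
Qed.

Lemma dyadicMz k x : dyadic x -> dyadic (2 ^ k * x).
Proof. by move=> dx; apply: dyadicM => //; exact: dyadic_exp. Qed.

Lemma dyadicMz_inv k x : dyadic (2 ^ k * x) -> dyadic x.
Proof.
move=> /(dyadicMz (- k)); rewrite mulrA -expfzDr// addrC subrr expr0z mul1r.
by [].
Qed.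

Lemma dyadic_half x : dyadic x -> dyadic (x / 2).
Proof. by move=> /(dyadicMz (-1)); rewrite mulrC exprN1. Qed.

Lemma dyadic0 : dyadic (0 : R). Proof. exact: (dyadic_int 0). Qed.
Lemma dyadic1 : dyadic (1 : R). Proof. exact: (dyadic_int 1). Qed.

Lemma small_pow2 x : 0 < x -> exists n, (2 : R) ^- n < x.
Proof.
move=> x0; exists (Num.trunc x^-1).+1.
rewrite -[ltRHS]invrK ltf_pV2 ?posrE ?exprn_gt0 ?invr_gt0//.
apply: (lt_trans (truncnS_gt _)).
by rewrite -natrX ltr_nat ltn_expl.
Qed.

Lemma dyadic_between x y : x < y -> exists2 d, dyadic d & x < d < y.
Proof.
move=> xy; have yx : 0 < y - x by rewrite subr_gt0.
have [n hn] := small_pow2 yx.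
have p0 : 0 < (2 : R) ^+ n by rewrite exprn_gt0.
(* This is the first point strictly above [x] on a grid of mesh less than [y - x]. *)
exists ((Num.floor (x * 2 ^+ n) + 1)%:~R / 2 ^+ n); first exact: dyadic_grid.
rewrite ltr_pdivlMr// ltr_pdivrMr// floorD1_gt/=.
have := floor_le (x * 2 ^+ n).
have : 2 ^+ n * 2 ^- n < 2 ^+ n * (y - x) by rewrite ltr_pM2l.
rewrite mulfV ?gt_eqF// rmorphD/= => h1 h2; lra.
Qed.

End Dyadic.

(** * Piecewise linear maps with dyadic breakpoints *)

Section PL.
Variable R : realType.
Implicit Types (F G : R -> R) (a b c d x y : R) (k m : int) (n : nat).

(** A dyadic constant together with a slope that is a power of two makes [F] both preserve and
    reflect dyadic points. *)
Definition affine_on F a b := exists k c, dyadic c /\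
  forall x, a <= x <= b -> F x = 2 ^ k * x + c.

(** The inductive form gives proofs by induction on the affine pieces. Both parts of [pl_cat] speak
    of the same [F] on closed intervals, so continuity at the cut is built in. *)
Inductive pl F : R -> R -> Prop :=
| pl_aff a b of dyadic a & dyadic b & a < b & affine_on F a b : pl F a b
| pl_cat a b c of pl F a b & pl F b c : pl F a c.

Lemma pl_lt F a b : pl F a b -> a < b.
Proof. by elim=> // a1 b1 c1 _ ab _ bc; exact: lt_trans bc. Qed.

Lemma pl_dyadic_ends F a b : pl F a b -> dyadic a /\ dyadic b.
Proof. by elim=> // a1 b1 c1 _ [? _] _ [_ ?]. Qed.

Lemma pl_ext F G a b : (forall x, a <= x <= b -> F x = G x) -> pl F a b -> pl G a b.
Proof.
move=> FG h; elim: h FG => {a b}.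
  move=> a b da db ab [k [c [dc e]]] FG; apply: pl_aff => //.
  by exists k, c; split=> // x xab; rewrite -FG// e.
move=> a b c h1 ih1 h2 ih2 FG; apply: (@pl_cat _ a b c).
  apply: ih1 => x /andP[ax xb]; apply: FG; rewrite ax (le_trans xb)//.
  exact: ltW (pl_lt h2).
apply: ih2 => x /andP[ax xb]; apply: FG; rewrite xb andbT (le_trans _ ax)//.
exact: ltW (pl_lt h1).
Qed.

Lemma pl_glue F G a b c : pl F a b -> pl G b c -> F b = G b ->
  pl (fun x => if x <= b then F x else G x) a c.
Proof.
move=> h1 h2 e; apply: (@pl_cat _ a b c).
  by apply: pl_ext h1 => x /andP[_ ->].
apply: pl_ext h2 => x /andP[bx _]; case: ifPn => // xb.
by have -> : x = b by apply/eqP; rewrite eq_le xb.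
Qed.

Lemma pl_mono F a b : pl F a b ->
  forall x y, a <= x -> x < y -> y <= b -> F x < F y.
Proof.
elim=> {a b}.
  move=> a b da db ab [k [c [dc e]]] x y ax xy yb.
  rewrite !e ?ax ?yb ?(ltW (le_lt_trans ax xy)) ?(le_trans (ltW xy))//.
  by rewrite ltrD2r ltr_pM2l// pow2_gt0.
move=> a b c h1 ih1 h2 ih2 x y ax xy yb.
have [xb|bx] := leP x b; have [yb'|by'] := leP y b.
- exact: ih1.
- apply: (@le_lt_trans _ _ (F b)); last by apply: ih2.
  by move: xb; rewrite le_eqVlt => /orP[/eqP->//|xb]; apply/ltW/ih1.
- by move: (lt_trans bx (lt_le_trans xy yb')); rewrite ltxx.
- by apply: ih2 => //; exact: ltW.
Qed.

Lemma pl_surj F a b : pl F a b ->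
  forall y, F a <= y <= F b -> exists2 x, a <= x <= b & F x = y.
Proof.
elim=> {a b}.
  move=> a b da db ab [k [c [dc e]]] y.
  rewrite !e ?lexx ?(ltW ab)//.
  rewrite -lerBrDr -(lerBlDr y c) => /andP[h1 h2].
  have xab : a <= (2 ^ k)^-1 * (y - c) <= b.
    by rewrite ler_pdivlMl ?pow2_gt0// ler_pdivrMl ?pow2_gt0// h1.
  exists ((2 ^ k)^-1 * (y - c)) => //.
  by rewrite e// mulVKf ?pow2_neq0// subrK.
move=> a b c h1 ih1 h2 ih2 y /andP[ya yc].
have [yb|yb] := leP y (F b).
  have [|x /andP[ax xb] <-] := ih1 y; first by rewrite ya.
  by exists x => //; rewrite ax (le_trans xb)// (ltW (pl_lt h2)).
have [|x /andP[ax xb] <-] := ih2 y; first by rewrite (ltW yb).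
by exists x => //; rewrite xb (le_trans _ ax)// (ltW (pl_lt h1)).
Qed.

Lemma pl_dyadic F a b : pl F a b ->
  forall x, a <= x <= b -> dyadic (F x) <-> dyadic x.
Proof.
elim=> {a b}.
  move=> a b da db ab [k [c [dc e]]] x xab; rewrite e//; split=> dx.
    by have := dyadicB dx dc; rewrite addrK => /dyadicMz_inv.
  by apply: dyadicD => //; exact: dyadicMz.
move=> a b c h1 ih1 h2 ih2 x /andP[ax xc].
by have [xb|xb] := leP x b; [apply: ih1; rewrite ax|apply: ih2; rewrite xc ltW].
Qed.

Lemma pl_sub F a b c d : pl F a b -> dyadic c -> dyadic d ->
  a <= c -> c < d -> d <= b -> pl F c d.
Proof.
move=> h; elim: h c d => {a b}.
  move=> a b da db ab [k [e [de h]]] c d dc dd ac cd db'.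
  apply: pl_aff => //; exists k, e; split=> // x /andP[cx xd].
  by apply: h; rewrite (le_trans ac)// (le_trans xd).
move=> a b e h1 ih1 h2 ih2 c d dc dd ac cd de.
have [_ db] := pl_dyadic_ends h1.
have [db'|bd] := leP d b; first exact: ih1.
have [bc|cb] := leP b c; first exact: ih2.
by apply: (@pl_cat _ c b d); [apply: ih1|apply: ih2].
Qed.

Lemma pl_post F a b k c : dyadic c -> pl F a b ->
  pl (fun x => 2 ^ k * F x + c) a b.
Proof.
move=> dc; elim=> {a b}; last first.
  by move=> a b e _ h1 _ h2; exact: pl_cat h1 h2.
move=> a b da db ab [l [e [de h]]]; apply: pl_aff => //.
exists (k + l), (2 ^ k * e + c); split.
  by apply: dyadicD => //; exact: dyadicMz.
by move=> x xab; rewrite h// mulrDr addrA mulrA expfzDr.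
Qed.

Lemma pl_pre F a b k c : dyadic c -> pl F (2 ^ k * a + c) (2 ^ k * b + c) ->
  pl (fun x => F (2 ^ k * x + c)) a b.
Proof.
move=> dc.
pose g (x : R) := 2 ^ (- k) * (x - c).
have gK x : 2 ^ k * g x + c = x.
  by rewrite /g mulrA -expfzDr// subrr expr0z mul1r subrK.
have gK' x : g (2 ^ k * x + c) = x.
  by rewrite /g addrK mulrA -expfzDr// addNr expr0z mul1r.
have gd x : dyadic x -> dyadic (g x).
  by move=> dx; apply: dyadicMz; exact: dyadicB.
(* Induction on [pl] needs variable endpoints, so [a] and [b] are first written as [g]-images of the
   endpoints of the hypothesis. *)
move=> h; rewrite -[a]gK' -[b]gK'; elim: h => [a' b' da db ab [l [e [de h]]]|]; last first.
  by move=> a1 b1 e _ h1 _ h2; exact: pl_cat h1 h2.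
apply: pl_aff; [exact: gd|exact: gd| |].
  by rewrite ltr_pM2l ?pow2_gt0// ltrD2r.
exists (l + k), (2 ^ l * c + e); split.
  by apply: dyadicD => //; exact: dyadicMz.
move=> x /andP[ax xb]; rewrite h; first by rewrite mulrDr mulrA -expfzDr// addrA.
rewrite -[in a' <= _](gK a') -[in _ <= b'](gK b') !lerD2r.
by rewrite !ler_pM2l ?pow2_gt0// ax.
Qed.

Lemma pl_id a b : dyadic a -> dyadic b -> a < b -> pl id a b.
Proof.
move=> da db ab; apply: pl_aff => //; exists 0, 0.
by split=> [|x _]; [exact: dyadic0|rewrite expr0z mul1r addr0].
Qed.

Lemma pl_trans F a b m : pl F a b ->
  pl (fun x => F (x - m%:~R) + m%:~R) (a + m%:~R) (b + m%:~R).
Proof.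
move=> h.
have h1 : pl (fun x => F (2 ^ 0 * x + (- m%:~R))) (a + m%:~R) (b + m%:~R).
  apply: pl_pre; first by apply: dyadicN; exact: dyadic_int.
  by rewrite !expr0z !mul1r !addrK.
have := pl_post 0 (dyadic_int R m) h1.
by apply: pl_ext => x _; rewrite !expr0z !mul1r.
Qed.

Definition periodic1 F := forall x, F (x + 1) = F x + 1.

Lemma periodicz F : periodic1 F -> forall x m, F (x + m%:~R) = F x + m%:~R.
Proof.
move=> F1; have Fn n z : F (z + n%:R) = F z + n%:R.
  by elim: n => [|n ih]; rewrite ?addr0// -addn1 natrD !addrA F1 ih.
move=> y [n|n]; first exact: Fn.
by rewrite NegzE rmorphN /= -pmulrn -[in RHS](subrK n.+1%:R y) Fn addrK.
Qed.

Lemma pl_periodic F a b m : periodic1 F ->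
  pl F a b -> pl F (a + m%:~R) (b + m%:~R).
Proof.
move=> F1 h; apply: pl_ext (pl_trans m h) => x _.
by rewrite -periodicz// subrK.
Qed.

(** * Interpolation between dyadic intervals *)

Lemma pl_stretch1 n : exists F, [/\ pl F 0 1, F 0 = 0 & F 1 = n.+1%:R].
Proof.
elim: n => [|n [F [h F0 F1]]].
  by exists id; split=> //; apply: pl_id; [exact: dyadic0|exact: dyadic1|].
(* The left half covers [[0, 1]]; the right half carries a rescaled copy of the previous map, moved
   up by 1. *)
exists (fun x => if x <= 1 / 2 then 2 * x else F (2 * x - 1) + 1); split; last 2 first.
- by rewrite divr_ge0// mulr0.
- rewrite ifF; last by apply/negbTE; rewrite -ltNge; lra.
  by rewrite mulr1 (_ : 2 - 1 = 1 :> R) ?F1 -?natr1//; lra.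
apply: pl_glue.
- apply: pl_aff; [exact: dyadic0|apply: dyadic_half; exact: dyadic1|lra|].
  by exists 1, 0; split=> [|x _]; [exact: dyadic0|rewrite expr1z addr0].
- have /(pl_post 0 (dyadic1 R)) : pl (fun x => F (2 ^ 1 * x + (- 1))) (1 / 2) 1.
    apply: pl_pre; first by apply: dyadicN; exact: dyadic1.
    have e0 : 2 * (1 / 2) + -1 = 0 :> R by lra.
    have e1 : 2 * 1 + -1 = 1 :> R by lra.
    by rewrite expr1z e0 e1.
  by apply: pl_ext => x _; rewrite expr0z mul1r expr1z.
- have e0 : 2 * (1 / 2) - 1 = 0 :> R by lra.
  have e1 : 2 * (1 / 2) = 1 :> R by lra.
  by rewrite e0 e1 F0 add0r.
Qed.

Lemma pl_stretch p q : (p <= q)%N ->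
  exists F, [/\ pl F 0 p.+1%:R, F 0 = 0 & F p.+1%:R = q.+1%:R].
Proof.
elim: p q => [|p ih] [|q]//; do ?by move=> _; exact: pl_stretch1.
rewrite ltnS => /ih[F [h F0 Fp]].
(* One more unit is appended to source and target by a piece of slope one. *)
exists (fun x => if x <= p.+1%:R then F x else x + (q.+1%:R - p.+1%:R)); split.
- apply: pl_glue => //; last by rewrite Fp addrCA subrr addr0.
  apply: pl_aff; do ?exact: dyadic_nat; first by rewrite ltr_nat.
  exists 0, (q.+1%:R - p.+1%:R); split=> [|x _]; last by rewrite expr0z mul1r.
  by apply: dyadicB; exact: dyadic_nat.
- by rewrite ler0n.
- by rewrite ler_nat ltnn -(natr1 p.+1) -(natr1 q.+1); lra.
Qed.

Lemma dyadic_pos_grid x : dyadic x -> 0 < x ->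
  exists p n, x = p.+1%:R / 2 ^+ n.
Proof.
move=> [m [n ->]]; rewrite pmulr_lgt0 ?invr_gt0 ?exprn_gt0// ltr0z.
by case: m => // -[//|p] _; exists p, n.
Qed.

(** Scaling by powers of two turns both lengths into positive integers, where [pl_stretch]
    applies. *)
Lemma pl_interp a b c d : dyadic a -> dyadic b -> dyadic c -> dyadic d ->
  a < b -> c < d -> exists F, [/\ pl F a b, F a = c & F b = d].
Proof.
move=> da db dc dd ab cd.
have [||p [n ep]] := @dyadic_pos_grid (b - a); rewrite ?subr_gt0//.
  exact: dyadicB.
have [||q [m eq]] := @dyadic_pos_grid (d - c); rewrite ?subr_gt0//.
  exact: dyadicB.
(* Refining the target grid by the factor 2^p makes the target at least as many units long as the
   source. *)
have pq : (p <= (q.+1 * 2 ^ p).-1)%N.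
  have := ltn_expl p (isT : 1 < 2)%N; nia.
have [F [h F0 Fp]] := pl_stretch pq.
have nq : (q.+1 * 2 ^ p).-1.+1 = (q.+1 * 2 ^ p)%N by rewrite prednK// muln_gt0 expn_gt0.
rewrite nq in Fp.
have ea : 2 ^ (n%:Z) * a + (- (2 ^ n%:Z * a)) = 0 by rewrite subrr.
have eb : 2 ^ (n%:Z) * b + (- (2 ^ n%:Z * a)) = p.+1%:R.
  rewrite -mulrN -mulrDr ep mulrC divfK// expf_neq0//.
exists (fun x => 2 ^ (- (m + p)%N%:Z) * F (2 ^ n%:Z * x + (- (2 ^ n%:Z * a))) + c); split.
- apply: pl_post => //; apply: pl_pre; first by apply: dyadicN; exact: dyadicMz.
  by rewrite ea eb.
- by rewrite ea F0 mulr0 add0r.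
- rewrite eb Fp natrM natrX -[RHS](subrK c) eq; congr (_ + _).
  rewrite PoszD opprD expfzDr// -!invr_expz mulrACA [X in X * _]mulrC.
  by rewrite [X in _ * X](_ : _ = 1) ?mulr1// mulVf// expf_neq0.
Qed.

End PL.

(** * Lifts of circle maps to the line *)

Local Notation tc := (@toCircle _).

Section Lifts.
Variable R : realType.
Implicit Types (F G : R -> R) (a b c d x y : R) (k m : int) (n : nat).
Implicit Types (f g h : homeo (circle R)).

Lemma tc_shift x m : tc (x + m%:~R) = tc x.
Proof. by apply/toCircleP; rewrite addrAC subrr add0r intr_int. Qed.

Lemma tc_eq x y : tc x = tc y -> exists m, x = y + m%:~R.
Proof. by move=> /toCircleP/intrP[m e]; exists m; rewrite -e addrC subrK. Qed.

Lemma tc_inj x y : tc x = tc y -> `|x - y| < 1 -> x = y.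
Proof. by move=> /toCircleP h /(int_lt1_eq0 h) /eqP; rewrite subr_eq0 => /eqP. Qed.

Lemma floor_rep a x : exists m, a <= x - m%:~R < a + 1.
Proof.
exists (Num.floor (x - a)); have := floor_itv (x - a).
by rewrite rmorphD/= => /andP[h1 h2]; lra.
Qed.

Lemma tc_rep a (p : circle R) : exists2 x, a <= x < a + 1 & tc x = p.
Proof.
have [x <-] := toCircle_surj p; have [m h] := floor_rep a x.
by exists (x - m%:~R) => //; rewrite -rmorphN tc_shift.
Qed.

Definition is_lift F (f : circle R -> circle R) :=
  [/\ periodic1 F, {homo F : x y / x < y} & forall x, tc (F x) = f (tc x)].

Lemma homo_lt_inj F : {homo F : x y / x < y} -> injective F.
Proof.
move=> h x y e; case: (ltgtP x y) => // /h; by rewrite e ltxx.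
Qed.

Lemma homo_lt_mono F : {homo F : x y / x < y} -> {mono F : x y / x < y}.
Proof.
move=> h x y; apply/idP/idP => [|/h//].
by apply: contraTT; rewrite -!leNgt le_eqVlt => /orP[/eqP->//|/h/ltW].
Qed.

Lemma homo_lt_mono_le F : {homo F : x y / x < y} -> {mono F : x y / x <= y}.
Proof. by move=> h x y; rewrite !leNgt homo_lt_mono. Qed.

(** An increasing map with a right inverse has no jumps: the preimages of [F x - e] and [F x + e]
    bracket a neighbourhood of [x]. *)
Lemma incr_bij_continuous F G : {homo F : x y / x < y} -> cancel G F ->
  continuous F.
Proof.
move=> h GK x; apply/cvgrPdist_lt => e e0.
have hG : {homo G : x y / x < y}.
  by move=> y z yz; rewrite -(homo_lt_mono h) !GK.
have h1 : G (F x - e) < x by rewrite -(homo_lt_mono h) GK; lra.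
have h2 : x < G (F x + e) by rewrite -(homo_lt_mono h) GK; lra.
near=> y.
have : G (F x - e) < y by near: y; exact: lt_nbhsr.
rewrite -(homo_lt_mono h) GK => y1.
have : y < G (F x + e) by near: y; exact: lt_nbhsl.
rewrite -(homo_lt_mono h) GK => y2.
by rewrite ltr_norml; apply/andP; split; lra.
Unshelve. all: by end_near. Qed.

Lemma incr_bij_inv F G : {homo F : x y / x < y} -> cancel G F ->
  cancel F G /\ {homo G : x y / x < y}.
Proof.
move=> h GK; split; first by move=> x; apply: (homo_lt_inj h); rewrite GK.
by move=> y z yz; rewrite -(homo_lt_mono h) !GK.
Qed.

Lemma homeo_of_lift F G : periodic1 F -> {homo F : x y / x < y} ->
  cancel G F -> exists f, is_lift F f.
Proof.
move=> F1 h GK; have [FK hG] := incr_bij_inv h GK.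
have G1 : periodic1 G.
  by move=> x; apply: (homo_lt_inj h); rewrite F1 !GK.
(* A periodic map descends to the circle through any choice of representatives; periodicity makes
   the value independent of the choice. *)
pose des (H : R -> R) (p : circle R) := tc (H (sval (cid (toCircle_surj p)))).
have desE H x : periodic1 H -> des H (tc x) = tc (H x).
  move=> H1; rewrite /des; case: cid => z /= /tc_eq[m ->].
  by rewrite periodicz// tc_shift.
have desK H K : periodic1 H -> periodic1 K -> cancel H K -> cancel (des H) (des K).
  by move=> H1 K1 HK p; have [x <-] := toCircle_surj p; rewrite !desE// HK.
have desC H K : periodic1 H -> {homo H : x y / x < y} -> cancel K H ->
    continuous (des H).
  move=> H1 hH KH; apply/quotient_continuous.
  have -> : des H \o \pi_(_)%qT = \pi_(circle R)%qT \o H.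
    by apply/funext => x /=; exact: desE.
  move=> x; apply: continuous_comp; last exact: pi_continuous.
  exact: incr_bij_continuous hH KH x.
exists (Homeo (desK _ _ F1 G1 FK) (desK _ _ G1 F1 GK) (desC _ _ F1 h GK) (desC _ _ G1 hG FK)).
by split=> // x /=; rewrite desE.
Qed.

(** * Recognizing elements of T by piecewise linear lifts *)

Lemma pl_breaks F a b : pl F a b -> exists s : seq R, (forall x, x \in s -> dyadic x) /\
  forall x, a <= x <= b -> x \in s \/
    exists k c, \forall y \near x, F y = 2 ^ k * y + c.
Proof.
elim=> {a b}.
  move=> a b da db ab [k [c [dc e]]]; exists [:: a; b]; split.
    by move=> x; rewrite !inE => /orP[]/eqP->.
  move=> x /andP[]; rewrite !inE le_eqVlt eq_sym => /orP[->|ax]; first by left.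
  rewrite le_eqVlt => /orP[->|xb]; first by left; rewrite orbT.
  right; exists k, c; near=> y; apply: e; apply/andP; split; apply: ltW.
    by near: y; exact: lt_nbhsr.
  by near: y; exact: lt_nbhsl.
move=> a b c _ [s [ds hs]] _ [t [dt ht]]; exists (s ++ t); split.
  by move=> x; rewrite mem_cat => /orP[/ds|/dt].
move=> x /andP[ax xc]; rewrite mem_cat; have [xb|xb] := leP x b.
  by have [|->|] := hs x; [rewrite ax|left|right].
by have [|->|] := ht x; [rewrite xc ltW|left; rewrite orbT|right].
Unshelve. all: by end_near. Qed.

Lemma is_lift_thompsonT F f a : is_lift F f -> pl F a (a + 1) -> thompsonT f.
Proof.
move=> [F1 h e] Fpl.
have dF x : dyadic (F x) <-> dyadic x.
  have [m /andP[h1 h2]] := floor_rep a x.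
  apply: (pl_dyadic (pl_periodic m F1 Fpl)).
  by apply/andP; split; [|apply: ltW]; lra.
have [s [ds hs]] := pl_breaks Fpl.
have nb p : ~ (tc @` [set` s]) p -> exists k, affine_at f (2 ^ k) p.
  move=> ns; have [x /andP[h1 h2] xp] := tc_rep a p.
  have [|xs|[k [c nr]]] := hs x; first by rewrite h1 ltW.
    by case: ns; exists x.
  exists k, x, c; split=> //; apply: filterS nr => y ey.
  by rewrite -e ey.
have bp : breakpoints f `<=` tc @` [set` s].
  move=> p hp; apply: contrapT => /nb[k hk]; exact: hp hk.
have fin : finite_set (tc @` [set` s] : set (circle R)).
  by apply: finite_image; exact: finite_seq.
split.
- apply/seteqP; split=> p.
    move=> [_ [x dx <-] <-]; rewrite -e; exists (F x) => //.
    by apply/dF.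
  move=> [x dx <-]; have [m /andP[h1 h2]] := floor_rep (F a) x.
  have [|z _ Fz] := pl_surj Fpl (y := x - m%:~R).
    by rewrite h1 F1 ltW.
  have Fz' : F (z + m%:~R) = x by rewrite periodicz// Fz subrK.
  exists (tc (z + m%:~R)); last by rewrite -e Fz'.
  by exists (z + m%:~R) => //; apply/dF; rewrite Fz'.
- exact: sub_finite_set bp fin.
- by move=> p /bp[x /= /ds dx <-]; exists x.
(* An affine germ at a cut persists at nearby points; one of them avoids the finite list of cuts,
   and there the slope is known to be a power of two. *)
- move=> b p; have [x <-] := toCircle_surj p => /affine_at_near hb.
  have [y [/nb[k hk] hy]] := avoid_finite fin hb.
  by exists k; apply: affine_at_uniq hy hk.
Qed.

(** The map [F] on one period is extended periodically, using the representative in [[a, a + 1)];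
    the condition on end values makes the extension agree with [F] at [a + 1] too. *)
Lemma thompsonT_of_pl F a : pl F a (a + 1) -> F (a + 1) = F a + 1 ->
  exists f G, [/\ thompsonT f, is_lift G f & forall x, a <= x <= a + 1 -> G x = F x].
Proof.
move=> Fpl Fa1.
pose G x := F (x - (Num.floor (x - a))%:~R) + (Num.floor (x - a))%:~R.
have GF x m : a <= x - m%:~R < a + 1 -> G x = F (x - m%:~R) + m%:~R.
  move=> /andP[h1 h2]; rewrite /G; suff -> : Num.floor (x - a) = m by [].
  by apply/eqP; rewrite floor_eq rmorphD/=; apply/andP; split; lra.
have GE x : a <= x <= a + 1 -> G x = F x.
  move=> /andP[h1]; rewrite le_eqVlt => /orP[/eqP ->|h2].
    rewrite (GF _ 1) ?addrK ?Fa1//; apply/andP; split; lra.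
  by rewrite (GF _ 0) ?subr0 ?addr0// h1.
have G1 : periodic1 G.
  move=> x; have [m h] := floor_rep a x.
  have e : x + 1 - (m + 1)%:~R = x - m%:~R by rewrite rmorphD/=; ring.
  by rewrite (GF _ (m + 1)) e// (GF _ m)// rmorphD/= addrA.
have lt1 x : a <= x < a + 1 -> F a <= F x < F a + 1.
  move=> /andP[h1 h2]; rewrite -Fa1 (pl_mono Fpl)// andbT.
  move: h1; rewrite le_eqVlt => /orP[/eqP->//|h1].
  by apply/ltW/(pl_mono Fpl) => //; exact: ltW.
have hG : {homo G : x y / x < y}.
  move=> x y xy; have [m hm] := floor_rep a x; have [n hn] := floor_rep a y.
  rewrite (GF _ _ hm) (GF _ _ hn).
  (* In the same period [F] is increasing; for different periods the values lie in unit intervals in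
     the order of [m] and [n]. *)
  have : m <= n.
    rewrite leNgt; apply/negP; rewrite -lezD1 -(ler_int R) rmorphD/= => h; lra.
  rewrite le_eqVlt => /orP[/eqP mn|].
    subst n; rewrite ltrD2r; apply: (pl_mono Fpl); lra.
  rewrite -lezD1 -(ler_int R) rmorphD/= => h.
  have := lt1 _ hm; have := lt1 _ hn; lra.
have Gsurj y : exists x, G x = y.
  have [m /andP[h1 h2]] := floor_rep (F a) y.
  have [|z hz Fz] := pl_surj Fpl (y := y - m%:~R); first by rewrite h1 Fa1 ltW.
  by exists (z + m%:~R); rewrite periodicz// GE// Fz subrK.
pose G' y := sval (cid (Gsurj y)).
have GK : cancel G' G by move=> y; rewrite /G'; case: cid.
have [f hf] := homeo_of_lift G1 hG GK.
exists f, G; split=> //; apply: is_lift_thompsonT hf _.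
by apply: pl_ext Fpl => x /GE ->.
Qed.

End Lifts.

(** * Every element of Thompson's group T has a lift *)

Section LiftOfThompson.
Variable R : realType.
Implicit Types (F G : R -> R) (a b c d x y : R) (k m : int) (n : nat).
Implicit Types (f g h : homeo (circle R)).

Lemma tc_continuous : continuous (tc : R -> circle R).
Proof. exact: pi_continuous. Qed.

Lemma tc_open y (Q : set (circle R)) :
  (\forall z \near y, Q (tc z)) -> \forall p \near tc y, Q p.
Proof.
(* The set [O] is invariant under integer translations, hence is the full preimage of its image.
   This is why the projection is open. *)
move=> hQ; pose O := [set z : R | \forall w \near z, Q (tc w)].
have oO : open O by exact: open_interior.
rewrite /prop_near1 nbhsE /=; exists (tc @` O); last first.
  by move=> _ [z hz <-]; exact: nbhs_singleton hz.
split; last by exists y.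
rewrite /open /= /quotient_open.
suff -> : \pi_(circle R)%qT @^-1` (tc @` O) = O by [].
apply/seteqP; split=> z /=; last by move=> hz; exists z.
move=> [w hw /tc_eq[m e]]; rewrite /O/= e in hw *.
have cv : (fun v : R => v + m%:~R) @ z --> z + m%:~R.
  by apply: cvgD; [exact: cvg_id|exact: cvg_cst].
have h1 := cv _ hw; near=> v; rewrite -(tc_shift v m); near: v; exact: h1.
Unshelve. all: by end_near.
Qed.

(** The circle is Hausdorff: with [r] the fractional part of [y - y'], the radius is half the
    distance from [y - y'] to the integers. A coincidence of nearby points would give an integer [j]
    strictly between 0 and 1. *)
Lemma tc_separated y y' : tc y <> tc y' ->
  exists2 e : R, 0 < e & forall z z', `|z - y| < e -> `|z' - y'| < e -> tc z <> tc z'.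
Proof.
move=> ne.
pose r := y - y' - (Num.floor (y - y'))%:~R.
have [r0 r1] : 0 <= r /\ r < 1.
  have := floor_itv (y - y'); rewrite rmorphD/= => /andP[? ?].
  by rewrite /r; split; lra.
have rn0 : r != 0.
  apply/eqP => r0'; apply: ne; apply/toCircleP.
  rewrite (_ : y - y' = (Num.floor (y - y'))%:~R) ?intr_int//.
  by apply/eqP; rewrite -subr_eq0 -/r r0'.
exists (Num.min r (1 - r) / 2).
  rewrite divr_gt0// lt_min; apply/andP; split; last by rewrite subr_gt0.
  by rewrite lt_neqAle eq_sym rn0.
have m1 : Num.min r (1 - r) <= r by rewrite ge_min lexx.
have m2 : Num.min r (1 - r) <= 1 - r by rewrite ge_min lexx orbT.
move=> z z'; rewrite !ltr_norml => /andP[h1 h2] /andP[h3 h4] /tc_eq[m e].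
have zz : z - z' = m%:~R by rewrite e addrC addKr.
pose j := m - Num.floor (y - y').
have ej : j%:~R = z - z' - (Num.floor (y - y'))%:~R :> R.
  by rewrite /j rmorphB/= zz.
have er : r = y - y' - (Num.floor (y - y'))%:~R by [].
have j0 : 0 < j%:~R :> R by clearbody j r; lra.
have j1 : j%:~R < 1%:~R :> R by clearbody j r; lra.
by move: j0 j1; rewrite ltr0z ltr_int; lia.
Qed.

Lemma near_right u v (P : R -> Prop) : u < v -> (\forall x \near u, P x) ->
  exists2 x, u < x < v & P x.
Proof.
move=> uv /nbhs_ballP[e /= e0 h].
pose x := u + Num.min e (v - u) / 2.
have m0 : 0 < Num.min e (v - u) by rewrite lt_min e0 subr_gt0.
have m1 : Num.min e (v - u) <= e by rewrite ge_min lexx.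
have m2 : Num.min e (v - u) <= v - u by rewrite ge_min lexx orbT.
exists x; first by rewrite /x; apply/andP; split; lra.
by apply: h; rewrite /ball/= /x ltr_norml; apply/andP; split; lra.
Qed.

Lemma near_left u v (P : R -> Prop) : u < v -> (\forall x \near v, P x) ->
  exists2 x, u < x < v & P x.
Proof.
move=> uv /nbhs_ballP[e /= e0 h].
pose x := v - Num.min e (v - u) / 2.
have m0 : 0 < Num.min e (v - u) by rewrite lt_min e0 subr_gt0.
have m1 : Num.min e (v - u) <= e by rewrite ge_min lexx.
have m2 : Num.min e (v - u) <= v - u by rewrite ge_min lexx orbT.
exists x; first by rewrite /x; apply/andP; split; lra.
by apply: h; rewrite /ball/= /x ltr_norml; apply/andP; split; lra.
Qed.

(** The first hypothesis says that [u] is in the closure of [A]. Two continuous maps into a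
    Hausdorff space that agree on [A] agree at [u]. *)
Lemma circle_limit_eq f a c (u : R) (A : set R) :
  (forall P : R -> Prop, (\forall x \near u, P x) -> exists2 x, A x & P x) ->
  (forall x, A x -> f (tc x) = tc (a * x + c)) ->
  f (tc u) = tc (a * u + c).
Proof.
move=> hA he; have [y0 ey0] := toCircle_surj (f (tc u)).
rewrite -ey0; apply: contrapT => /tc_separated[e e0 he2].
have Qn : \forall p \near tc y0, forall z', `|z' - (a * u + c)| < e -> p <> tc z'.
  apply: tc_open; apply/nbhs_ballP; exists e => // z; rewrite /ball/= => hz z' hz'.
  by apply: he2 => //; rewrite distrC.
have c1 : (f \o tc) @ u --> f (tc u).
  by apply: continuous_comp; [exact: tc_continuous|exact: homeo_cont].
have c2 : (fun x => a * x + c) @ u --> a * u + c.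
  by apply: cvgD; [apply: cvgM; [exact: cvg_cst|exact: cvg_id]|exact: cvg_cst].
rewrite -ey0 in c1.
have n1 : \forall x \near u, forall z', `|z' - (a * u + c)| < e -> f (tc x) <> tc z'.
  exact: c1 _ Qn.
have n2 : \forall x \near u, `|a * x + c - (a * u + c)| < e.
  by move/cvgrPdist_lt: c2 => /(_ _ e0); apply: filterS => x; rewrite distrC.
have n3 : \forall x \near u, (forall z', `|z' - (a * u + c)| < e -> f (tc x) <> tc z')
   /\ `|a * x + c - (a * u + c)| < e.
  by apply: filterS2 n1 n2 => x.
by have [x Ax [h1 h2]] := hA _ n3; apply: (h1 _ h2); exact: he.
Qed.

(** The local affine formulas fit together by connectedness of [(u, v)]: the set where the formula
    found at the midpoint holds locally is open and closed. The end points follow by taking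
    limits. *)
Lemma affine_between f u v : thompsonT f -> u < v ->
  (forall x, u < x < v -> ~ breakpoints f (tc x)) ->
  exists k c, forall x, u <= x <= v -> f (tc x) = tc (2 ^ k * x + c).
Proof.
move=> [_ _ _ fS] uv nb.
have la x : u < x < v -> exists k c, \forall y \near x, f (tc y) = tc (2 ^ k * y + c).
  move=> /nb/nbreakpoint[a ha]; have [k ak] := fS _ _ ha.
  by exists k; rewrite -ak; exact: affine_atE ha _.
have wuv : u < (u + v) / 2 < v by apply/andP; split; lra.
have [k [c hw]] := la _ wuv; exists k, c.
pose P := [set y : R | f (tc y) = tc (2 ^ k * y + c)].
pose D := [set x : R | \forall y \near x, ~ P° y].
have coni : connected `]u, v[%classic.
  by apply/connected_intervalP; exact: interval_is_interval.
(* The same set is cut out of the interval by the open set [P°] and by the closed complement of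
   [D]. *)
have eB : `]u, v[%classic `&` P° = `]u, v[%classic `&` ~` D.
  apply/seteqP; split=> x /= [xuv].
    by move=> hx; split=> // /nbhs_singleton; apply.
  move=> nD; split=> //; apply: contrapT => nP; apply: nD.
  move: (xuv); rewrite in_itv/= => /la[k' [c' h']].
  have : \forall y \near x, \forall z \near y, f (tc z) = tc (2 ^ k' * z + c').
    exact: nbhs_interior h'.
  rewrite /D/=; apply: filterS => y hy hPy; apply: nP.
  (* Two affine germs of [f] at the same point have equal slopes, and then their constants differ by
     an integer. *)
  have ek : 2 ^ k' = 2 ^ k :> R.
    by apply: (@affine_at_uniq _ f _ _ (tc y)); [exists y, c'|exists y, c].
  have := nbhs_singleton hPy; have := nbhs_singleton hy; rewrite /P/= => -> /tc_eq[m].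
  rewrite ek -addrA => /addrI ec.
  by apply: filterS h' => z; rewrite /P/= ek ec addrA tc_shift.
have hB : `]u, v[%classic `&` P° = `]u, v[%classic.
  apply: coni.
  - by exists ((u + v) / 2); split=> //=; rewrite ?in_itv.
  - by exists (P°) => //; exact: open_interior.
  - by exists (~` D) => //; apply: open_closedC; exact: open_interior.
have hin x : u < x < v -> f (tc x) = tc (2 ^ k * x + c).
  move=> xuv; have : (`]u, v[%classic `&` P°) x by rewrite hB /= in_itv.
  by case=> _ /nbhs_singleton.
move=> x /andP[]; rewrite le_eqVlt => /orP[/eqP <- _|ux].
  apply: (@circle_limit_eq f _ _ u [set x | u < x < v]) => // Q hQ.
  exact: near_right uv hQ.
rewrite le_eqVlt => /orP[/eqP ->|xv]; last by apply: hin; rewrite ux.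
apply: (@circle_limit_eq f _ _ v [set x | u < x < v]) => // Q hQ.
exact: near_left uv hQ.
Qed.

Lemma dyadic_common_grid (s : seq (circle R)) :
  (forall p, p \in s -> dyadic_circle p) ->
  exists n, forall p, p \in s -> exists m, p = tc (m%:~R / 2 ^+ n).
Proof.
elim: s => [|p s ih] hs; first by exists 0%N.
have [|n hn] := ih; first by move=> q qs; apply: hs; rewrite inE qs orbT.
have [_ [m [n' ->]] ep] := hs p (mem_head _ _).
have ref j i i' : j%:~R / 2 ^+ i = (j * Posz (2 ^ i')%N)%:~R / 2 ^+ (i + i') :> R.
  rewrite rmorphM /= -pmulrn natrX exprD; field.
  by rewrite !expf_neq0.
exists (n + n')%N => q; rewrite inE => /orP[/eqP ->|/hn[j ->]].
  by exists (m * Posz (2 ^ n)%N); rewrite -ep addnC -ref.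
by exists (j * Posz (2 ^ n')%N); rewrite -ref.
Qed.

Lemma dyadic_tc x : dyadic_circle (tc x) -> dyadic x.
Proof.
by move=> [y dy /esym/tc_eq[m ->]]; apply: dyadicD => //; exact: dyadic_int.
Qed.

Lemma pl_periodic_all F : periodic1 F -> pl F 0 1 ->
  forall a b, dyadic a -> dyadic b -> a < b -> pl F a b.
Proof.
move=> F1 Fpl a b da db ab.
have up n : pl F 0 n.+1%:R.
  elim: n => [//|n ih]; apply: (pl_cat ih).
  have := pl_periodic n.+1 F1 Fpl.
  by rewrite add0r -[1 + _]/(1%:R + n.+1%:R) -natrD.
have [m /andP[m1 m2]] := floor_rep 0 a.
have [j /andP[j1 j2]] := floor_rep 0 b.
have mj : m <= j.
  by rewrite -ltzD1 -(ltr_int R) rmorphD/=; lra.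
have [n en] : exists n : nat, j = m + n%:Z by exists `|j - m|%N; lia.
apply: (pl_sub (pl_periodic m F1 (up n))) => //.
  by lra.
have -> : n.+1%:R = (n%:Z)%:~R + 1 :> R by rewrite -natr1.
by move: j2; rewrite en rmorphD/=; lra.
Qed.

(** All breakpoints lie on one grid of mesh 2^-n, so [f] is given by one affine formula on each grid
    interval. These are glued from 0 to 1 and extended periodically, once the total increment is
    known to be 1. *)
Lemma is_lift_of_thompsonT f : thompsonT f -> exists F, is_lift F f /\
  forall a b, dyadic a -> dyadic b -> a < b -> pl F a b.
Proof.
move=> Tf; have [fD fF fB fS] := Tf.
have /finite_seqP[s es] := fF.
have [n hn] : exists n, forall p, p \in s -> exists m, p = tc (m%:~R / 2 ^+ n).
  apply: dyadic_common_grid => p ps; apply: fB; by rewrite es.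
pose g i : R := i%:R / 2 ^+ n.
have p0 : 0 < (2 : R) ^+ n by rewrite exprn_gt0.
have gS i : g i < g i.+1 by rewrite /g ltr_pM2r ?invr_gt0// ltr_nat.
have dg i : dyadic (g i) by exact: (dyadic_grid _ (Posz i)).
have nb i x : g i < x < g i.+1 -> ~ breakpoints f (tc x).
  move=> /andP[h1 h2]; rewrite es => /= /hn[m /tc_eq[j ej]].
  have e : x = (m + j * Posz (2 ^ n)%N)%:~R / 2 ^+ n.
    rewrite ej rmorphD rmorphM /= -[(Posz (2 ^ n))%:~R]pmulrn natrX; field.
    by rewrite expf_neq0.
  move: h1 h2; rewrite /g e !ltr_pM2r ?invr_gt0//.
  rewrite -![_%:R]/((Posz _)%:~R) !ltr_int; lia.
have fdy x : dyadic x -> dyadic_circle (f (tc x)).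
  by move=> dx; rewrite -fD; exists (tc x) => //; exists x.
(* The constant of each new piece is corrected by an integer so that the values match at the
   junction. *)
have step i : exists F, pl F 0 (g i.+1) /\
    forall x, 0 <= x <= g i.+1 -> tc (F x) = f (tc x).
  elim: i => [|i [F [Fpl eF]]].
    have [k [c hc]] := affine_between Tf (gS 0%N) (nb 0%N).
    have g0 : g 0%N = 0 by rewrite /g mul0r.
    exists (fun x => 2 ^ k * x + c); split; last by move=> x; rewrite -g0 => /hc.
    apply: pl_aff; rewrite -?g0//; exists k, c; split=> //.
    have := fdy _ (dg 0%N); rewrite hc ?lexx ?ltW// => /dyadic_tc.
    by rewrite g0 mulr0 add0r.
  have [k [c hc]] := affine_between Tf (gS i.+1) (nb i.+1).
  have gi0 : 0 <= g i.+1 by exact: ltW (pl_lt Fpl).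
  have : tc (F (g i.+1)) = tc (2 ^ k * g i.+1 + c).
    by rewrite eF ?hc ?lexx ?gi0// ltW.
  move=> /tc_eq[m em].
  exists (fun x => if x <= g i.+1 then F x else 2 ^ k * x + (c + m%:~R)); split.
    apply: pl_glue => //; last by rewrite em addrA.
    apply: pl_aff => //; exists k, (c + m%:~R); split=> //.
    have dF : dyadic (F (g i.+1)) by apply/(pl_dyadic Fpl) => //; rewrite gi0 lexx.
    have := dyadicB dF (dyadicMz k (dg i.+1)).
    by rewrite em (_ : _ - _ = c + m%:~R)//; ring.
  move=> x /andP[x0 x1]; case: ifPn => xg; first by rewrite eF// x0.
  rewrite addrA tc_shift hc// x1 andbT ltW// ltNge.
  exact: xg.
have [F [Fpl eF]] := step (2 ^ n).-1.
have e1 : g (2 ^ n).-1.+1 = 1.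
  by rewrite prednK ?expn_gt0// /g natrX divff// expf_neq0.
rewrite e1 in Fpl eF.
have F01 : F 0 < F 1 by apply: (pl_mono Fpl).
have [m em] : exists m, F 1 = F 0 + m%:~R.
  by apply: tc_eq; rewrite !eF ?lexx ?ler01// -[in LHS](add0r 1) (tc_shift 0 1).
have m1 : m = 1.
  apply/eqP; rewrite eq_le; apply/andP; split; last first.
    by rewrite -[1]add0r lezD1 -(ltr0z R); lra.
  rewrite leNgt; apply/negP; rewrite -(ltr_int R) => lt1m.
  (* If the increment exceeded 1, the value [F 0 + 1] would be taken in [[0, 1]]; injectivity of [f]
     forces the point to be 0 or 1, and neither has that value. *)
  have [|x /andP[x0 x1] Fx] := pl_surj Fpl (y := F 0 + 1); first by lra.
  have : tc x = tc 0.
    apply: (can_inj (@homeoK _ f)); rewrite -!eF ?lexx ?ler01 ?x0// Fx.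
    exact: (tc_shift (F 0) 1).
  move=> /tc_eq[j]; rewrite add0r => xj.
  have jj : (0 <= j) && (j <= 1) by rewrite -(ler0z R) -(ler_int R) -xj x0.
  have [j0|j1] : j = 0 \/ j = 1 by lia.
    by move: Fx; rewrite xj j0; lra.
  by move: Fx; rewrite xj j1 em; lra.
have [||f' [G [_ [G1 Gm _] GE]]] := @thompsonT_of_pl _ F 0.
- by rewrite add0r.
- by rewrite add0r em m1.
rewrite add0r in GE.
exists G; split.
  split=> // x; have [j /andP[h1 h2]] := floor_rep 0 x.
  have -> : x = x - j%:~R + j%:~R by rewrite subrK.
  rewrite periodicz// !tc_shift GE ?eF// ?h1 ltW//; move: h2; rewrite add0r//.
apply: pl_periodic_all => //; apply: pl_ext Fpl => x /GE ->//.
Qed.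

End LiftOfThompson.

(** * Gluing and transitivity *)

Section LiftToolkit.
Variable R : realType.
Implicit Types (F G : R -> R) (a b c d e x y : R) (k m : int) (n : nat).
Implicit Types (f g h : homeo (circle R)).

Lemma thompsonT1 : thompsonT (1%g : homeo (circle R)).
Proof. by have [] := thompsonT_subgroup R. Qed.

Lemma thompsonTM f g : thompsonT f -> thompsonT g -> thompsonT (f * g)%g.
Proof. by have [_ h _] := thompsonT_subgroup R; exact: h. Qed.

Lemma thompsonTV f : thompsonT f -> thompsonT (f^-1)%g.
Proof. by have [_ _ h] := thompsonT_subgroup R; exact: h. Qed.

Lemma thompsonTJ f g : thompsonT f -> thompsonT g -> thompsonT (f ^ g)%g.
Proof.
move=> Tf Tg; apply: thompsonTM; first exact: thompsonTV.
exact: thompsonTM.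
Qed.

Lemma thompsonTX f n : thompsonT f -> thompsonT (f ^+ n)%g.
Proof.
move=> Tf; elim: n => [|n ih]; first exact: thompsonT1.
by rewrite expgS; exact: thompsonTM.
Qed.

Lemma homeoME f g p : (f * g)%g p = g (f p). Proof. by []. Qed.
Lemma homeo_invK f : cancel f (f^-1)%g. Proof. exact: (@homeoK _ f). Qed.
Lemma homeo_Kinv f : cancel (f^-1)%g f. Proof. exact: (@homeoVK _ f). Qed.

Lemma homeo_inj f : injective f. Proof. exact: can_inj (homeo_invK f). Qed.

Lemma homeo_ext f g : (forall p, f p = g p) -> f = g.
Proof. by move=> h; apply/homeoP/funext. Qed.

Lemma homeo_ext_tc f g : (forall x, f (tc x) = g (tc x)) -> f = g.
Proof.
by move=> h; apply: homeo_ext => p; have [x <-] := toCircle_surj p.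
Qed.

Lemma conjg_fixed f g p : f ((g^-1)%g p) = (g^-1)%g p -> (f ^ g)%g p = p.
Proof. by move=> e; rewrite /conjg !homeoME e homeo_Kinv. Qed.

(** If [f] fixes [p], then at [g p] either [f] acts trivially or [g] does, and in the latter case
    injectivity gives [g p = p]. *)
Lemma disjoint_commute f g : (forall p, f p = p \/ g p = p) -> (f * g = g * f)%g.
Proof.
move=> h; apply: homeo_ext => p; rewrite !homeoME.
have [fp|gp] := h p.
  by rewrite fp; have [//|/homeo_inj ->] := h (g p); rewrite fp.
by rewrite gp; have [/homeo_inj ->|//] := h (f p); rewrite gp.
Qed.

Lemma is_lift1 : is_lift id (1%g : homeo (circle R)).
Proof. by split. Qed.

Lemma is_lift_shift F f m : is_lift F f -> is_lift (fun x => F x + m%:~R) f.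
Proof.
move=> [F1 h e]; split=> [x|x y xy|x]; first by rewrite F1 addrAC.
- by rewrite ltrD2r h.
- by rewrite tc_shift e.
Qed.

Lemma is_lift_comp F G f g : is_lift F f -> is_lift G g ->
  is_lift (G \o F) (f * g)%g.
Proof.
move=> [F1 h e] [G1 h' e']; split=> [x|x y xy|x] /=; first by rewrite F1 G1.
- by apply: h'; exact: h.
- by rewrite e' e.
Qed.

(** At each point the lifts differ by an integer. Within one period both grow by less than 1, so
    this integer cannot change. *)
Lemma is_lift_unique F G f : is_lift F f -> is_lift G f ->
  exists m, forall x, F x = G x + m%:~R.
Proof.
move=> [F1 h e] [G1 h' e'].
have ex x : exists m, F x = G x + m%:~R by apply: tc_eq; rewrite e e'.
have [m em] := ex 0; exists m.
have near0 x y : 0 <= x < 1 -> F x = G x + m%:~R.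
  move=> /andP[]; rewrite le_eqVlt => /orP[/eqP <- //|x0 x1].
  have [j ej] := ex x; suff -> : m = j by [].
  have f1 : F x < F 0 + 1 by rewrite -F1 add0r h.
  have g1 : G x < G 0 + 1 by rewrite -G1 add0r h'.
  have := h _ _ x0; have := h' _ _ x0; rewrite ej em in f1 * => g0 f0.
  have : (j - m)%:~R < 1%:~R :> R by rewrite rmorphB/=; lra.
  have : (- 1)%:~R < (j - m)%:~R :> R by rewrite rmorphB rmorphN/=; lra.
  by rewrite !ltr_int; lia.
move=> x; have [i hi] := floor_rep 0 x; rewrite add0r in hi.
by rewrite -(subrK i%:~R x) !periodicz// (near0 _ x hi) addrAC.
Qed.

Lemma is_lift_pl F f : thompsonT f -> is_lift F f ->
  forall a b, dyadic a -> dyadic b -> a < b -> pl F a b.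
Proof.
move=> Tf hF a b da db ab; have [G [hG Gpl]] := is_lift_of_thompsonT Tf.
have [m em] := is_lift_unique hF hG.
apply: pl_ext (pl_post 0 (dyadic_int R m) (Gpl a b da db ab)) => x _.
by rewrite em expr0z mul1r.
Qed.

Lemma is_lift_at f x y : thompsonT f -> f (tc x) = tc y ->
  exists2 F, is_lift F f & F x = y.
Proof.
move=> Tf fxy; have [F [hF _]] := is_lift_of_thompsonT Tf.
have [_ _ e] := hF; have [m em] : exists m, y = F x + m%:~R.
  by apply: tc_eq; rewrite e.
by exists (fun x => F x + m%:~R); [exact: is_lift_shift|rewrite em].
Qed.

(** A lift of the inverse composed with [F] lifts the identity, so it is an integer translation,
    which is then subtracted. *)
Lemma is_lift_inv F f : thompsonT f -> is_lift F f ->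
  exists G, [/\ is_lift G (f^-1)%g, cancel F G & cancel G F].
Proof.
move=> Tf hF; have [G [hG _]] := is_lift_of_thompsonT (thompsonTV Tf).
have := is_lift_comp hF hG; rewrite mulgV => hFG.
have [m em] := is_lift_unique hFG is_lift1.
exists (fun x => G x + (- m)%:~R).
have FK : cancel F (fun x => G x + (- m)%:~R).
  by move=> x; have /= -> := em x; rewrite rmorphN addrK.
have hG' := is_lift_shift (- m) hG; split=> // x.
have [_ h' _] := hG'; apply: (homo_lt_inj h').
by rewrite FK.
Qed.

Lemma is_lift_surj F f y : thompsonT f -> is_lift F f -> exists x, F x = y.
Proof. by move=> Tf /(is_lift_inv Tf)[G [_ _ GK]]; exists (G y). Qed.

Lemma is_lift_mono F f : is_lift F f -> {mono F : x y / x < y}.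
Proof. by move=> [_ h _]; exact: homo_lt_mono. Qed.

Lemma is_lift_monoW F f : is_lift F f -> {mono F : x y / x <= y}.
Proof. by move=> [_ h _]; exact: homo_lt_mono_le. Qed.

Lemma is_lift_tc F f x : is_lift F f -> f (tc x) = tc (F x).
Proof. by case. Qed.

Lemma is_lift_dyadic F f x : thompsonT f -> is_lift F f ->
  dyadic (F x) <-> dyadic x.
Proof.
move=> Tf hF; have [m /andP[m1 m2]] := floor_rep 0 x.
apply: (pl_dyadic (is_lift_pl Tf hF (dyadic_int R m) (dyadic_int R (m + 1)) _)).
  by rewrite ltr_int ltzD1.
by rewrite rmorphD/=; lra.
Qed.

(** Continuity from the right, in the form used to choose short arcs: strict inequalities at [x]
    persist on [[x, x + d]]. *)
Lemma is_lift_right F f x y z : thompsonT f -> is_lift F f -> F x < y -> x < z ->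
  exists2 d, 0 < d & forall t, x <= t <= x + d -> F t < y /\ t < z.
Proof.
move=> Tf hF Fxy xz; have [w ew] := is_lift_surj y Tf hF.
have xw : x < w by rewrite -(is_lift_mono hF) ew.
have m1 : Num.min w z <= w by rewrite ge_min lexx.
have m2 : Num.min w z <= z by rewrite ge_min lexx orbT.
have m0 : x < Num.min w z by rewrite lt_min xw.
exists ((Num.min w z - x) / 2); first lra.
move=> t /andP[t1 t2]; split; last lra.
by rewrite -ew (is_lift_mono hF); lra.
Qed.

Lemma thompsonT_glue F G a b : pl F a b -> pl G b (a + 1) -> F b = G b ->
  G (a + 1) = F a + 1 ->
  exists f H, [/\ thompsonT f, is_lift H f, forall x, a <= x <= b -> H x = F x
    & forall x, b <= x <= a + 1 -> H x = G x].
Proof.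
move=> hF hG Fb Ga.
have ab := pl_lt hF; have ba := pl_lt hG.
have [|f [H [Tf hH eH]]] := thompsonT_of_pl (pl_glue hF hG Fb).
  have nb : (a + 1 <= b) = false by apply/negbTE; rewrite -ltNge.
  by rewrite nb (ltW ab) Ga.
exists f, H; split=> // x /andP[x1 x2].
  by rewrite eH ?x1 ?x2// (le_trans x2)// ltW.
have ax : a <= x by rewrite (le_trans (ltW ab)).
rewrite eH ?ax ?x2//; case: ifPn => // xb.
by have -> : x = b by apply/eqP; rewrite eq_le xb.
Qed.

(** * Elements supported on an arc *)

Definition supported f a b := forall x, b <= x <= a + 1 -> f (tc x) = tc x.

Lemma supported_glue F a b : a < b -> b < a + 1 -> pl F a b -> F a = a -> F b = b ->
  exists f, [/\ thompsonT f, supported f a b & forall x, a <= x <= b -> f (tc x) = tc (F x)].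
Proof.
move=> ab ba hF Fa Fb; have [da db] := pl_dyadic_ends hF.
have [|||f [H [Tf hH e1 e2]]] := @thompsonT_glue F id a b hF.
- apply: pl_id => //; apply: dyadicD => //; exact: dyadic1.
- exact: Fb.
- by rewrite Fa.
exists f; split=> // x xab; first by rewrite (is_lift_tc _ hH) e2.
by rewrite (is_lift_tc _ hH) e1.
Qed.

(** The gaps on both sides of [[c, d]] are filled by interpolation with [a] and [e] fixed, and the
    identity is used on the rest of the circle. *)
Lemma extend_in a c d e S : dyadic a -> dyadic e -> e < a + 1 -> pl S c d ->
  a < c -> a < S c -> d < e -> S d < e ->
  exists f, [/\ thompsonT f, supported f a e & forall x, c <= x <= d -> f (tc x) = tc (S x)].
Proof.
move=> da de ea hS ac aSc de1 de2.
have cd := pl_lt hS; have [dc dd] := pl_dyadic_ends hS.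
have dSc : dyadic (S c) by apply/(pl_dyadic hS); rewrite ?lexx ?ltW.
have dSd : dyadic (S d) by apply/(pl_dyadic hS); rewrite ?lexx ?ltW.
have [A [hA Aa Ac]] := pl_interp da dc da dSc ac aSc.
have [B [hB Bd Be]] := pl_interp dd de dSd de de1 de2.
have h1 := pl_glue hS hB (esym Bd).
have e1 : A c = (if c <= d then S c else B c) by rewrite ltW.
have h2 := pl_glue hA h1 e1.
have [|||f [Tf sf ef]] := supported_glue _ ea h2.
- by lra.
- by rewrite ltW.
- have n1 : (e <= c) = false by apply/negbTE; rewrite -ltNge; lra.
  have n2 : (e <= d) = false by apply/negbTE; rewrite -ltNge.
  by rewrite n1 n2.
exists f; split=> // x /andP[x1 x2]; rewrite ef; last by apply/andP; split; lra.
case: ifPn => xc; last by rewrite x2.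
by have -> : x = c; [apply/eqP; rewrite eq_le xc|rewrite Ac].
Qed.

Lemma splice F G f g a b : thompsonT f -> thompsonT g -> is_lift F f -> is_lift G g ->
  dyadic a -> dyadic b -> a < b -> b < a + 1 -> F a = G a -> F b = G b ->
  exists h H, [/\ thompsonT h, is_lift H h, forall x, a <= x <= b -> H x = F x
    & forall x, b <= x <= a + 1 -> H x = G x].
Proof.
move=> Tf Tg hF hG da db ab ba Fa Fb.
have da1 : dyadic (a + 1) by apply: dyadicD => //; exact: dyadic1.
apply: thompsonT_glue => //.
- exact: is_lift_pl hF _ _ _ _ _.
- exact: is_lift_pl hG _ _ _ _ _.
- by have [G1 _ _] := hG; rewrite G1 Fa.
Qed.

(** * Transitivity of T on cyclically ordered dyadic tuples *)

Lemma pl_interp_seq xs ys x0 y0 : size xs = size ys -> (0 < size xs)%N ->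
  dyadic x0 -> dyadic y0 -> (forall x, x \in xs -> dyadic x) ->
  (forall y, y \in ys -> dyadic y) -> path <%R x0 xs -> path <%R y0 ys ->
  exists F, [/\ pl F x0 (last x0 xs), F x0 = y0 & map F xs = ys].
Proof.
elim: xs ys x0 y0 => [|x xs ih] [|y ys]// x0 y0 [sz] _ dx0 dy0 dxs dys.
move=> /= /andP[x0x pxs] /andP[y0y pys].
have dx : dyadic x by apply: dxs; exact: mem_head.
have dy : dyadic y by apply: dys; exact: mem_head.
have [A [hA Ax0 Ax]] := pl_interp dx0 dx dy0 dy x0x y0y.
case: xs ys sz ih dxs dys pxs pys => [|x' xs] [|y' ys]//=.
  by move=> *; exists A; rewrite Ax.
move=> [sz] ih dxs dys pxs pys.
have [| | | |||||B [hB Bx eB]] := ih (y' :: ys) x y => //=; first by rewrite sz.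
- by move=> z zs; apply: dxs; rewrite inE zs orbT.
- by move=> z zs; apply: dys; rewrite inE zs orbT.
exists (fun z => if z <= x then A z else B z); split.
- by apply: pl_glue => //; rewrite Ax.
- by rewrite ltW.
- rewrite lexx Ax; congr (_ :: _).
  rewrite -[RHS]eB.
  suff E : {in x' :: xs, (fun z => if z <= x then A z else B z) =1 B}.
    by have /eq_in_map := E; apply.
  move=> z zs.
  have /(order_path_min lt_trans)/allP/(_ z zs) : path <%R x (x' :: xs) by [].
  by move=> xz; rewrite leNgt xz.
Qed.

Lemma thompsonT_transitive xs ys x0 y0 : size xs = size ys ->
  dyadic x0 -> dyadic y0 -> (forall x, x \in xs -> dyadic x) ->
  (forall y, y \in ys -> dyadic y) ->
  path <%R x0 (rcons xs (x0 + 1)) -> path <%R y0 (rcons ys (y0 + 1)) ->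
  exists f F, [/\ thompsonT f, is_lift F f, F x0 = y0 & map F xs = ys].
Proof.
move=> sz dx0 dy0 dxs dys pxs pys.
have d1 z : dyadic z -> dyadic (z + 1) by move=> dz; apply: dyadicD => //; exact: dyadic1.
have [||||F [hF Fx0 eF]] := pl_interp_seq _ _ dx0 dy0 _ _ pxs pys.
- by rewrite !size_rcons sz.
- by rewrite size_rcons.
- by move=> x; rewrite mem_rcons inE => /orP[/eqP ->|/dxs//]; exact: d1.
- by move=> x; rewrite mem_rcons inE => /orP[/eqP ->|/dys//]; exact: d1.
rewrite last_rcons in hF; rewrite map_rcons in eF; have /rcons_inj[eF1 eF2] := eF.
have [|f [G [Tf hG eG]]] := thompsonT_of_pl hF; first by rewrite eF2 Fx0.
exists f, G; split=> //; first by rewrite eG// lexx lerDl ler01.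
rewrite -[RHS]eF1; apply/eq_in_map => z zs; apply: eG.
have zs' : z \in rcons xs (x0 + 1) by rewrite mem_rcons inE zs orbT.
have /allP/(_ z zs')/ltW -> := order_path_min lt_trans pxs.
have : sorted <%R (rcons xs (x0 + 1)) by exact: path_sorted pxs.
rewrite -cats1 (sorted_pairwise lt_trans) pairwise_cat => /and3P[+ _ _].
by rewrite allrel1r => /allP/(_ z zs)/ltW.
Qed.

End LiftToolkit.

(** * Cells and rotations of trees *)

(** A binary tree encodes a subdivision of a cell by successive halvings; the leaves are the
    resulting cells. *)
Inductive tree := Leaf | Node of tree & tree.

Fixpoint nodes t := if t is Node l r then (nodes l + nodes r).+1 else 0%N.

Fixpoint vine n := if n is n.+1 then Node Leaf (vine n) else Leaf.

Fixpoint full n := if n is n.+1 then Node (full n) (full n) else Leaf.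

Section Cells.
Variable R : realType.
Implicit Types (F G : R -> R) (a b c d e x y : R) (k m : int) (n : nat).
Implicit Types (f g h : homeo (circle R)) (t : tree).

(* The cell (c, d) is the arc of the circle from c to c + d. *)
Local Notation cell := (R * R)%type.
Implicit Types (u v w : cell) (L : seq cell).

Definition lc u : cell := (u.1, u.2 / 2).
Definition rc u : cell := (u.1 + u.2 / 2, u.2 / 2).

Fixpoint cells t u := if t is Node l r then cells l (lc u) ++ cells r (rc u) else [:: u].

Definition incell u p := exists2 s : R, 0 <= s <= 1 & p = tc (u.1 + u.2 * s).

(** The common parameter [s] expresses affinity without slopes, and is stable under halving,
    composition and inversion. *)
Definition caff f u v := forall s : R, 0 <= s <= 1 ->
  f (tc (u.1 + u.2 * s)) = tc (v.1 + v.2 * s).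

Lemma caff_lc f u v : caff f u v -> caff f (lc u) (lc v).
Proof.
move=> h s /andP[s0 s1]; rewrite /= -!mulrA; apply: h.
by apply/andP; split; lra.
Qed.

Lemma caff_rc f u v : caff f u v -> caff f (rc u) (rc v).
Proof.
move=> h s /andP[s0 s1]; rewrite /=.
have e w : w.1 + w.2 / 2 + w.2 / 2 * s = w.1 + w.2 * ((1 + s) / 2) by field.
by rewrite !e; apply: h; apply/andP; split; lra.
Qed.

Lemma incell_halves u p : incell u p -> incell (lc u) p \/ incell (rc u) p.
Proof.
move=> [s /andP[s0 s1] ->]; have [s2|s2] := leP s (1 / 2).
  left; exists (2 * s); first by apply/andP; split; lra.
  by rewrite /=; congr tc; field.
right; exists (2 * s - 1); first by apply/andP; split; lra.
by rewrite /=; congr tc; field.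
Qed.

Lemma caff_comp f g u v w : caff f u v -> caff g v w -> caff (f * g)%g u w.
Proof. by move=> h h' s s01; rewrite homeoME h// h'. Qed.

Lemma caff_inv f u v : caff f u v -> caff (f^-1)%g v u.
Proof. by move=> h s s01; rewrite -h// homeo_invK. Qed.

Lemma caff_eq f g u v p : caff f u v -> caff g u v -> incell u p -> f p = g p.
Proof. by move=> h h' [s s01 ->]; rewrite h// h'. Qed.

(** For the leaf lists of two trees this is a tree pair diagram of [f]. *)
Fixpoint caffs f L L' := match L, L' with
  | [::], [::] => True
  | u :: L, v :: L' => caff f u v /\ caffs f L L'
  | _, _ => False
  end.

Lemma caffs_cat f L1 L1' L2 L2' : caffs f L1 L1' -> caffs f L2 L2' ->
  caffs f (L1 ++ L2) (L1' ++ L2').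
Proof. by elim: L1 L1' => [|u L1 ih] [|v L1']//= [h1 h2] h3; split=> //; exact: ih. Qed.

Lemma caffs_comp f g L1 L2 L3 : caffs f L1 L2 -> caffs g L2 L3 ->
  caffs (f * g)%g L1 L3.
Proof.
elim: L1 L2 L3 => [|u L1 ih] [|v L2] [|w L3]//= [h1 h2] [h3 h4].
by split; [exact: caff_comp h3|exact: ih h4].
Qed.

Lemma caffs_inv f L1 L2 : caffs f L1 L2 -> caffs (f^-1)%g L2 L1.
Proof.
elim: L1 L2 => [|u L1 ih] [|v L2]//= [h1 h2].
by split; [exact: caff_inv|exact: ih].
Qed.

Lemma caffs_size f L1 L2 : caffs f L1 L2 -> size L1 = size L2.
Proof. by elim: L1 L2 => [|u L1 ih] [|v L2]//= [_ /ih ->]. Qed.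

Lemma caffs_eq f g L L' v p : caffs f L L' -> caffs g L L' -> v \in L ->
  incell v p -> f p = g p.
Proof.
elim: L L' => [|u L ih] [|u' L']//= [h1 h2] [h3 h4].
rewrite inE => /orP[/eqP ->|vL]; last exact: ih h2 h4 vL.
exact: caff_eq h1 h3.
Qed.

Lemma caff_cells f u v t : caff f u v -> caffs f (cells t u) (cells t v).
Proof.
elim: t u v => [|l ihl r ihr] u v h //=.
by apply: caffs_cat; [apply: ihl; exact: caff_lc|apply: ihr; exact: caff_rc].
Qed.

Lemma cells_cover t u p : incell u p -> exists2 v, v \in cells t u & incell v p.
Proof.
elim: t u => [|l ihl r ihr] u h /=; first by exists u => //; rewrite inE.
have [/ihl[v vl hv]|/ihr[v vr hv]] := incell_halves h; exists v => //.
  by rewrite mem_cat vl.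
by rewrite mem_cat vr orbT.
Qed.

Lemma size_cells t u : size (cells t u) = (nodes t).+1.
Proof. by elim: t u => //= l ihl r ihr u; rewrite size_cat ihl ihr addSn addnS. Qed.

Definition supp f u := supported f u.1 (u.1 + u.2).

Definition small u := 0 < u.2 < 1.

Lemma small_lc u : small u -> small (lc u).
Proof. by rewrite /small/= => /andP[? ?]; apply/andP; split; lra. Qed.

Lemma small_rc u : small u -> small (rc u).
Proof. by rewrite /small/= => /andP[? ?]; apply/andP; split; lra. Qed.

Lemma cell_or_out u p : incell u p \/ exists2 x, u.1 + u.2 <= x < u.1 + 1 & p = tc x.
Proof.
have [x /andP[x0 x1] <-] := tc_rep u.1 p.
have [ux|xu] := leP (u.1 + u.2) x; first by right; exists x; rewrite ?ux.
have u0 : 0 < u.2 by lra.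
left; exists ((x - u.1) / u.2).
  apply/andP; split; first by apply: divr_ge0; lra.
  by rewrite ler_pdivrMr// mul1r; lra.
by congr tc; rewrite mulrC divfK ?gt_eqF// addrC subrK.
Qed.

Lemma supp_out f u x : supp f u -> u.1 + u.2 <= x < u.1 + 1 -> f (tc x) = tc x.
Proof. by move=> h /andP[x0 x1]; apply: h; rewrite x0 ltW. Qed.

Lemma supp_eq f g u : supp f u -> supp g u ->
  (forall p, incell u p -> f p = g p) -> f = g.
Proof.
move=> sf sg h; apply: homeo_ext => p.
have [/h//|[x hx ->]] := cell_or_out u p.
by rewrite (supp_out sf)// (supp_out sg).
Qed.

Lemma supp1 u : supp 1%g u. Proof. by []. Qed.

Lemma suppM f g u : supp f u -> supp g u -> supp (f * g)%g u.
Proof. by move=> sf sg x hx; rewrite homeoME sf// sg. Qed.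

Lemma suppV f u : supp f u -> supp (f^-1)%g u.
Proof. by move=> sf x hx; rewrite -[in LHS]sf// homeo_invK. Qed.

Lemma supp_rc f u : small u -> supp f (rc u) -> supp f u.
Proof.
by move=> /andP[u0 u1] sf x /andP[x0 x1]; apply: sf; rewrite /=; apply/andP; split; lra.
Qed.

Lemma supp_rc_lc f u : small u -> supp f (rc u) -> caff f (lc u) (lc u).
Proof.
(* One turn later, the left half lies between the end of [rc u] and its start plus 1, the range in
   which [supp] is stated. *)
move=> /andP[u0 u1] sf s /andP[s0 s1]; rewrite -(tc_shift _ 1) -[_%:~R]/1.
have h1 : 0 <= u.2 / 2 * s by rewrite mulr_ge0//; lra.
have h2 : u.2 / 2 * s <= u.2 / 2 by rewrite ler_piMr//; lra.
by apply: sf; rewrite /=; apply/andP; split; lra.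
Qed.

Lemma supp_incell f u p : supp f u -> incell u p -> incell u (f p).
Proof.
move=> sf up; have [//|[x hx ex]] := cell_or_out u (f p).
have := suppV sf; move=> /supp_out/(_ hx); rewrite -ex homeo_invK => pe.
by rewrite -pe.
Qed.

(** Points outside [v] come under [g] from points outside [u], up to the common end point, and [f]
    fixes those. *)
Lemma supp_conj f g u v : small u -> small v -> supp f u -> caff g u v ->
  supp (f ^ g)%g v.
Proof.
move=> su sv sf guv y /andP[y0 y1].
have /andP[u0 u1] := su; have /andP[v0 v1] := sv.
apply: (@conjg_fixed _ f g (tc y)).
have [x /andP[x0 x1] xe] := tc_rep u.1 ((g^-1)%g (tc y)); rewrite -xe.
have [ux|xu] := leP (u.1 + u.2) x; first by apply: supp_out sf _; rewrite ux.
pose s := (x - u.1) / u.2.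
have s0 : 0 <= s by apply: divr_ge0; lra.
have s1 : s < 1 by rewrite ltr_pdivrMr// mul1r; lra.
have ex : x = u.1 + u.2 * s by rewrite /s mulrC divfK ?gt_eqF// addrC subrK.
have : tc y = tc (v.1 + v.2 * s).
  by rewrite -(guv s) -?ex ?xe ?homeo_Kinv// s0 ltW.
move=> /tc_eq[m em].
have h1 : 0 <= v.2 * s by rewrite mulr_ge0// ltW.
have h2 : v.2 * s < v.2 by rewrite gtr_pMr.
(* A point of the closed complement of [v] that also lies in [v] with parameter [s < 1] can only be
   the left end, reached after one turn. *)
have m0 : 0 < m by rewrite -(ltr0z R); lra.
have m1 : m <= 1 by rewrite -(ler_int R); lra.
have em1 : m = 1 by apply/eqP; rewrite eq_le m1 -[1]add0r lezD1.
have vs0 : v.2 * s = 0 by rewrite em em1 in y1; rewrite -[1%:~R]/1 in y1; lra.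
have x0' : x = u.1.
  by move/eqP: vs0; rewrite mulf_eq0 gt_eqF//= ex => /eqP ->; rewrite mulr0 addr0.
rewrite x0' -(tc_shift _ 1); apply: sf; rewrite -[1%:~R]/1; apply/andP; split; lra.
Qed.

(* Thompson's generator x_0 of F, rescaled to the cell u. *)
Definition is_gen u f := [/\ caff f (lc (lc u)) (lc u),
  caff f (rc (lc u)) (lc (rc u)), caff f (rc u) (rc (rc u)) & supp f u].

Lemma is_gen_conj f g u v : small u -> small v -> is_gen u f -> caff g u v ->
  is_gen v (f ^ g)%g.
Proof.
move=> su sv [h1 h2 h3 h4] guv; split; last exact: supp_conj h4 guv.
- apply: caff_comp (caff_inv (caff_lc (caff_lc guv))) _.
  by apply: caff_comp h1 _; exact: caff_lc.
- apply: caff_comp (caff_inv (caff_rc (caff_lc guv))) _.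
  by apply: caff_comp h2 _; apply: caff_lc; exact: caff_rc.
- apply: caff_comp (caff_inv (caff_rc guv)) _.
  by apply: caff_comp h3 _; apply: caff_rc; exact: caff_rc.
Qed.

(** The generator is affine on three pieces, so it carries arbitrary subtrees [p], [q], [r] along:
    it acts as the rotation at the root. *)
Lemma is_gen_rotate f u p q r : is_gen u f ->
  caffs f (cells (Node (Node p q) r) u) (cells (Node p (Node q r)) u).
Proof.
move=> [h1 h2 h3 _] /=; rewrite -catA.
by do ?apply: caffs_cat; exact: caff_cells.
Qed.

Lemma is_gen_iter f u n : is_gen u f -> caff f (iter n.+1 rc u) (iter n.+2 rc u).
Proof. by move=> [_ _ h _]; elim: n => //= n ih; exact: caff_rc. Qed.

Lemma small_iter_rc u n : small u -> small (iter n rc u).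
Proof. by move=> su; elim: n => //= n ih; exact: small_rc. Qed.

(** * Generation of F by two elements, through rotation to a vine *)

Section Generation.
Variables (P : set (homeo (circle R))) (u : cell).
Hypotheses (Pgrp : is_subgroup P) (u_small : small u).
Hypotheses (P0 : exists2 f, P f & is_gen u f) (P1 : exists2 f, P f & is_gen (rc u) f).

(** This is x_{n+1} = x_n^{x_0} for n >= 1: conjugation by x_0 moves the support one cell further
    down the right spine. *)
Lemma gen_iter n : exists2 f, P f & is_gen (iter n rc u) f.
Proof.
have [_ PM PV] := Pgrp; case: n => // n; elim: n => // n [f Pf gf].
have [g Pg gg] := P0; exists (f ^ g)%g.
  exact: (PM _ _ (PV _ Pg) (PM _ _ Pf Pg)).
by apply: is_gen_conj gf (is_gen_iter n gg); exact: small_iter_rc.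
Qed.

(** Rotations at the cells of the right spine turn any tree into the right vine with the same number
    of nodes. The position [k] on the spine varies in the induction. *)
Lemma to_vine t (k : nat) : exists g, [/\ P g, supp g (iter k rc u) &
  caffs g (cells t (iter k rc u)) (cells (vine (nodes t)) (iter k rc u))].
Proof.
have [PI PM PV] := Pgrp.
elim: {t}(nodes t) {-2}t (leqnn (nodes t)) k => [|n ihn] [|l r]//= ltn k.
- by exists 1%g.
- by exists 1%g.
(* As long as the left subtree is a node, a root rotation makes it smaller; once it is a leaf, the
   induction continues in the right half. *)
elim: l r ltn => [|p ihp q _] r /= ltn.
  rewrite add0n; rewrite add0n in ltn; have [g [Pg sg cg]] := ihn r ltn k.+1.
  have sk := small_iter_rc k u_small.
  exists g; split=> //; first exact: supp_rc.
  by split=> //; exact: supp_rc_lc.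
have e : (nodes p + nodes (Node q r) = (nodes p + nodes q).+1 + nodes r)%N.
  by rewrite /= addnS addnA.
have [|g [Pg sg cg]] := ihp (Node q r); first by rewrite e.
have [f Pf gf] := gen_iter k.
exists (f * g)%g; split; first exact: PM.
  by have [_ _ _ sf] := gf; exact: suppM.
rewrite e in cg; exact: caffs_comp (is_gen_rotate p q r gf) cg.
Qed.

(** Both trees are rotated to the same vine, and [f] is the first rotation followed by the inverse
    of the second. *)
Lemma trees_generated f s t : supp f u -> caffs f (cells s u) (cells t u) -> P f.
Proof.
have [PI PM PV] := Pgrp; move=> sf cf.
have [g [Pg sg cg]] := to_vine s 0; have [h [Ph sh ch]] := to_vine t 0.
have e : nodes s = nodes t.
  by have := caffs_size cf; rewrite !size_cells => -[].
rewrite -e in ch.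
suff -> : f = (g * h^-1)%g by apply: PM => //; exact: PV.
apply: (supp_eq sf) => [|p up]; first by apply: suppM => //; exact: suppV.
have [v vs vp] := cells_cover s up.
exact: caffs_eq cf (caffs_comp cg (caffs_inv ch)) vs vp.
Qed.

End Generation.

End Cells.

(** * Generators of the elements supported in a cell *)

Section DyadicTrees.
Variable R : realType.
Implicit Types (F G : R -> R) (a b c d e x y : R) (k m : int) (n : nat).
Implicit Types (f g h : homeo (circle R)) (t : tree).
Local Notation cell := (R * R)%type.
Implicit Types (u v w : cell) (L : seq cell).

(** * Dyadic subdivisions as leaf lists of trees *)

Fixpoint desc n u v : Prop := if n is n.+1 then
  v = u \/ desc n (lc u) v \/ desc n (rc u) v else v = u.

Lemma desc_le n n' u v : (n <= n')%N -> desc n u v -> desc n' u v.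
Proof.
elim: n n' u => [|n ih] [|n'] u //=; first by move=> _ ->; left.
by rewrite ltnS => nn' [|[]] h; [left|right; left; exact: ih h|right; right; exact: ih h].
Qed.

Lemma desc_bounds n u v : 0 < u.2 -> desc n u v ->
  [/\ 0 < v.2, u.1 <= v.1 & v.1 + v.2 <= u.1 + u.2].
Proof.
elim: n u => [|n ih] u u0 /=; first by move=> ->.
have u2 : 0 < u.2 / 2 by lra.
move=> [->//|[/ih/=|/ih/=]] /(_ u2)[h1 h2 h3]; split=> //; lra.
Qed.

Lemma desc_grid n u (j : nat) : (j < 2 ^ n)%N ->
  desc n u (u.1 + u.2 * (j%:R / 2 ^+ n), u.2 / 2 ^+ n).
Proof.
elim: n u j => [|n ih] u j /=.
  by case: j => //= _; rewrite mul0r mulr0 addr0 expr0 divr1; case: u.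
rewrite expnS mul2n -addnn => jn; right.
have p0 : (2 : R) ^+ n != 0 by rewrite expf_neq0.
have [j2|j2] := ltnP j (2 ^ n)%N; [left|right].
  have := ih (lc u) j j2; congr desc.
  by congr pair; rewrite /= exprS; field.
have j3 : (j - 2 ^ n < 2 ^ n)%N by rewrite ltn_subLR.
have := ih (rc u) _ j3; congr desc.
by congr pair; rewrite /= exprS ?natrB ?natrX//; field.
Qed.

Fixpoint chain L a b := if L is v :: L then v.1 = a /\ chain L (v.1 + v.2) b else a = b.

Lemma chain_cat L1 L2 a b c : chain L1 a b -> chain L2 b c -> chain (L1 ++ L2) a c.
Proof. by elim: L1 a => [a -> //|v L1 ih] a /= [-> h1] h2; split=> //; exact: ih. Qed.

Lemma chain_ge L a b v : (forall w, w \in L -> 0 < w.2) -> chain L a b ->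
  v \in L -> a <= v.1.
Proof.
elim: L a => [//|w L ih] a pos /= [<- h]; rewrite inE => /orP[/eqP ->//|vL].
have pw : 0 < w.2 by apply: pos; exact: mem_head.
apply: le_trans (ih _ _ h vL); first by rewrite lerDl ltW.
by move=> z zL; apply: pos; rewrite inE zL orbT.
Qed.

(** A proper descendant of [u] lies in one of its halves, so no member of the chain straddles the
    midpoint. *)
Lemma chain_split n u L a : 0 < u.2 -> (forall v, v \in L -> desc n.+1 u v /\ v <> u) ->
  chain L a (u.1 + u.2) -> u.1 <= a -> a <= u.1 + u.2 / 2 ->
  exists L1 L2, [/\ L = L1 ++ L2, chain L1 a (u.1 + u.2 / 2),
    chain L2 (u.1 + u.2 / 2) (u.1 + u.2) & forall v, v \in L1 -> desc n (lc u) v].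
Proof.
move=> u0; elim: L a => [|v L ih] a hL.
  by move=> /= ->; move=> h1 h2; lra.
move=> hc ua; rewrite le_eqVlt => /orP[/eqP am|am].
  by exists [::], (v :: L); split=> //; rewrite -am.
move: hc => /= [va hc]; subst a.
have [dv vu] := hL v (mem_head _ _).
have u2 : 0 < u.2 / 2 by lra.
move: dv => /= [//|[dl|dr]]; last first.
  by have [_ /= h1 _] := desc_bounds (u := rc u) u2 dr; lra.
have [v0 /= _ v1] := desc_bounds (u := lc u) u2 dl.
have [||| L1 [L2 [-> c1 c2 d1]]] := ih (v.1 + v.2) _ hc; do ?lra.
  by move=> w wL; apply: hL; rewrite inE wL orbT.
exists (v :: L1), L2; split=> //= w; rewrite inE => /orP[/eqP ->//|].
exact: d1.
Qed.

(** Either [u] itself is the first and then the only cell, or the chain splits at the midpoint and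
    induction on the depth gives the two subtrees. *)
Lemma chain_cells n u L : 0 < u.2 -> (forall v, v \in L -> desc n u v) ->
  chain L u.1 (u.1 + u.2) -> exists t, L = cells t u.
Proof.
have full1 w L' : 0 < w.2 -> (forall v, v \in L' -> 0 < v.2 /\ v.1 + v.2 <= w.1 + w.2) ->
    chain L' (w.1 + w.2) (w.1 + w.2) -> L' = [::].
  case: L' => // v L' w0 hL /= [v1 _]; have [v0 vw] := hL v (mem_head _ _); exfalso; lra.
elim: n u L => [|n ih] u [|v L] u0 hL /=; do ?by move=> h; lra.
- move=> [_]; have /= -> := hL v (mem_head _ _) => hc.
  exists Leaf; congr (_ :: _); apply: (full1 u) => // w wL.
  by have /= -> := hL w; rewrite ?inE ?wL ?orbT.
- move=> [v1 hc].
  have bd w : w \in v :: L -> [/\ 0 < w.2, u.1 <= w.1 & w.1 + w.2 <= u.1 + u.2].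
    by move=> /hL; exact: desc_bounds.
  have [v0 _ _] := bd v (mem_head _ _).
  have posL w : w \in L -> 0 < w.2 by move=> wL; have [] := bd w; rewrite ?inE ?wL ?orbT.
  have geL := chain_ge posL hc.
  have [vu|vu] := eqVneq v u.
    subst v; exists Leaf; congr (_ :: _); apply: (full1 u) => // w wL.
    by have [] := bd w; rewrite ?inE ?wL ?orbT.
  have hL' w : w \in v :: L -> desc n.+1 u w /\ w <> u.
    move=> wL; split; first exact: hL.
    move: wL; rewrite inE => /orP[/eqP ->|wL wu]; first exact/eqP.
    by have := geL _ wL; rewrite wu v1; lra.
  have hc' : chain (v :: L) u.1 (u.1 + u.2) by split.
  have [||L1 [L2 [e c1 c2 d1]]] := chain_split u0 hL' hc'; do ?lra.
  have u2 : 0 < u.2 / 2 by lra.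
  have [t1 e1] := ih (lc u) L1 u2 d1 c1.
  have pos2 w : w \in L2 -> 0 < w.2.
    by move=> w2; have [] := bd w; rewrite // e mem_cat w2 orbT.
  have [||t2 e2] := ih (rc u) L2 u2.
  + move=> w w2; have := hL' w; rewrite e mem_cat w2 orbT => /(_ isT)[/= + wu].
    move=> [//|[dl|//]]; have [w0 /= _] := desc_bounds (u := lc u) u2 dl.
    by have := chain_ge pos2 c2 w2; lra.
  + by rewrite /= (_ : _ + u.2 / 2 + _ = u.1 + u.2)//; field.
  by exists (Node t1 t2); rewrite /= -e1 -e2.
Qed.

Lemma caffs_image f F u t v :
  (forall w, w \in cells t v -> exists w' n, [/\ caff f w w', w'.1 = F w.1,
      w'.1 + w'.2 = F (w.1 + w.2) & desc n u w']) ->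
  exists L n, [/\ caffs f (cells t v) L, chain L (F v.1) (F (v.1 + v.2))
    & forall w, w \in L -> desc n u w].
Proof.
elim: t v => [|l ihl r ihr] v /= h.
  have [w' [n [h1 h2 h3 h4]]] := h v (mem_head _ _).
  exists [:: w'], n; split=> //= w; by rewrite inE => /eqP ->.
have [|L1 [n1 [a1 b1 c1]]] := ihl (lc v).
  by move=> w wl; apply: h; rewrite mem_cat wl.
have [|L2 [n2 [a2 b2 c2]]] := ihr (rc v).
  by move=> w wl; apply: h; rewrite mem_cat wl orbT.
exists (L1 ++ L2), (maxn n1 n2); split; first exact: caffs_cat.
  apply: chain_cat b1 _; rewrite /= in b2 *.
  by rewrite (_ : v.1 + v.2 = v.1 + v.2 / 2 + v.2 / 2)//; field.
move=> w; rewrite mem_cat => /orP[/c1|/c2]; apply: desc_le.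
  by rewrite leq_maxl.
by rewrite leq_maxr.
Qed.

Lemma full_grid n u w : w \in cells (full n) u ->
  exists2 i : nat, (i < 2 ^ n)%N & w = (u.1 + u.2 * (i%:R / 2 ^+ n), u.2 / 2 ^+ n).
Proof.
have p0 l : (2 : R) ^+ l != 0 by rewrite expf_neq0.
elim: n u => [|n ih] u /=.
  by rewrite inE => /eqP ->; exists 0%N => //; rewrite mul0r mulr0 addr0 expr0 divr1; case: u.
rewrite mem_cat => /orP[/ih[i hi ->]|/ih[i hi ->]].
  exists i; first by rewrite expnS mul2n -addnn (leq_trans hi)// leq_addr.
  by congr pair; rewrite /= exprS; field.
exists (2 ^ n + i)%N; first by rewrite expnS mul2n -addnn ltn_add2l.
by congr pair; rewrite /= exprS ?natrD ?natrX; field.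
Qed.

(** On a sufficiently fine grid every interval is mapped affinely onto a standard dyadic interval
    [[j 2^m, (j + 1) 2^m]]: fineness makes the constant of each piece an integer multiple of the
    image length. *)
Lemma pl_grid G a b : pl G a b -> exists n0, forall n, (n0 <= n)%N -> forall i : int,
  a <= i%:~R / 2 ^+ n -> (i + 1)%:~R / 2 ^+ n <= b ->
  exists m j, forall s : R, 0 <= s <= 1 ->
    G ((i%:~R + s) / 2 ^+ n) = (j%:~R + s) * 2 ^ m.
Proof.
have p0 l : (2 : R) ^+ l != 0 by rewrite expf_neq0.
elim=> {a b}.
  move=> a b da db ab [k [_ [[c [e ->]] h]]].
  exists (`|k| + e)%N => n hn i ai ib.
  have [q hq] : exists q : nat, n%:Z = k + e%:Z + q%:Z.
    by exists (absz (n%:Z - k - e%:Z)%R); lia.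
  exists (k - n%:Z), (i + c * Posz (2 ^ q)%N) => s /andP[s0 s1].
  rewrite h; last first.
    apply/andP; split; [apply: le_trans ai _|apply: le_trans _ ib].
      by rewrite ler_pM2r ?invr_gt0 ?exprn_gt0// lerDl.
    by rewrite ler_pM2r ?invr_gt0 ?exprn_gt0// rmorphD lerD2l.
  rewrite rmorphD rmorphM /= -[(Posz (2 ^ q))%:~R]pmulrn natrX.
  have e1 : (2 : R) ^+ q = 2 ^ (n%:Z - k - e%:Z) by rewrite (_ : _ - _ = q%:Z)//; lia.
  rewrite e1 -![_ ^+ n]/(2 ^ n%:Z) -![_ ^+ e]/(2 ^ e%:Z).
  rewrite !expfzDr// -!invr_expz; field.
  by rewrite !expfz_neq0.
move=> a b c h1 [n1 ih1] h2 [n2 ih2].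
have [_ [j [e eb]]] := pl_dyadic_ends h1.
exists (maxn e (maxn n1 n2)) => n; rewrite !geq_max => /and3P[en n1n n2n] i ai ic.
have [q hq] : exists q, n = (e + q)%N by exists (n - e)%N; rewrite subnKC.
have eb' : b = (j * Posz (2 ^ q)%N)%:~R / 2 ^+ n.
  rewrite eb hq rmorphM /= -[(Posz (2 ^ q))%:~R]pmulrn natrX exprD; field.
  by rewrite !p0.
have [ij|ij] := leP (i + 1) (j * Posz (2 ^ q)%N).
  by apply: ih1 => //; rewrite eb' ler_pM2r ?invr_gt0 ?exprn_gt0// ler_int.
apply: ih2 => //; rewrite eb' ler_pM2r ?invr_gt0 ?exprn_gt0// ler_int; lia.
Qed.

(** The exponent starts at 1, so a dyadic cell has length at most 1/2 and is never the whole
    circle. *)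
Definition dcell u := dyadic u.1 /\ exists n, u.2 = 2 ^ (- (n.+1)%:Z).

Lemma dcell_small u : dcell u -> small u.
Proof.
move=> [_ [n e]]; rewrite /small e pow2_gt0/= -invr_expz invf_lt1 ?exprn_gt0//.
by rewrite -[2 ^ _]/(2 ^+ n.+1) exprn_egt1// ltr1n.
Qed.

(** * Tree pairs for elements supported in a cell *)

Lemma supp_lift f u : small u -> thompsonT f -> supp f u ->
  exists F, [/\ is_lift F f, F u.1 = u.1 & F (u.1 + u.2) = u.1 + u.2].
Proof.
move=> /andP[u0 u1] Tf sf.
have fu x : u.1 + u.2 <= x <= u.1 + 1 -> f (tc x) = tc x by exact: sf.
have fa : f (tc u.1) = tc u.1.
  by rewrite -(tc_shift _ 1) fu// -[1%:~R]/1; apply/andP; split; lra.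
have [F hF Fa] := is_lift_at Tf fa.
have [F1 Fh _] := hF; exists F; split=> //.
apply: tc_inj; first by rewrite -(is_lift_tc _ hF) fu//; apply/andP; split; lra.
have h1 : F u.1 < F (u.1 + u.2) by apply: Fh; lra.
have h2 : F (u.1 + u.2) < F (u.1 + 1) by apply: Fh; lra.
by rewrite F1 Fa in h2; rewrite Fa in h1; rewrite ltr_norml; apply/andP; split; lra.
Qed.

(** The source tree is a full tree fine enough for [pl_grid]; the image cells are then descendants
    of [u] and form the leaves of the target tree. *)
Lemma supp_trees f u : dcell u -> thompsonT f -> supp f u ->
  exists s t, caffs f (cells s u) (cells t u).
Proof.
move=> du Tf sf; have /andP[u0 u1] := dcell_small du.
have [da [n0 eu]] := du.
have db : dyadic (u.1 + u.2) by apply: dyadicD => //; rewrite eu; exact: dyadic_exp.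
have [F [hF Fa Fb]] := supp_lift (dcell_small du) Tf sf.
have Fpl : pl F u.1 (u.1 + u.2) by apply: is_lift_pl hF _ _ _ _ _ => //; lra.
(* [G] is [F] transported from [u] to the unit interval. *)
pose G y := 2 ^ n0.+1%:Z * F (2 ^ (- n0.+1%:Z) * y + u.1) + (- (2 ^ n0.+1%:Z * u.1)).
have Gpl : pl G 0 1.
  apply: pl_post; first by apply: dyadicN; exact: dyadicMz.
  by apply: pl_pre => //; rewrite mulr0 add0r mulr1 -eu addrC.
have u2n : u.2 * 2 ^ n0.+1%:Z = 1 by rewrite eu -expfzDr// addNr expr0z.
have GF y : F (u.1 + u.2 * y) = u.1 + u.2 * G y.
  rewrite /G -mulrN -mulrDr mulrA u2n mul1r -eu [u.2 * y + _]addrC.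
  by rewrite addrCA subrr addr0.
have G0 : G 0 = 0.
  have := GF 0; rewrite mulr0 addr0 Fa => /eqP; rewrite -subr_eq0 opprD addNKr oppr_eq0.
  by rewrite mulf_eq0 gt_eqF//= => /eqP.
have G1 : G 1 = 1.
  have := GF 1; rewrite mulr1 Fb => /addrI e.
  by apply: (mulfI (lt0r_neq0 u0)); rewrite mulr1 -e.
have [N hN] := pl_grid Gpl; have {}hN := hN N (leqnn _).
have pN : 0 < (2 : R) ^+ N by rewrite exprn_gt0.
have [L [n [h1 h2 h3]]] : exists L n, [/\ caffs f (cells (full N) u) L,
    chain L (F u.1) (F (u.1 + u.2)) & forall w, w \in L -> desc n u w].
  apply: caffs_image => w /full_grid[i iN ->].
  have [||m [j hj]] := hN (Posz i).
  - by rewrite divr_ge0// ltW.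
  - rewrite ler_pdivrMr// mul1r -natrX -[leRHS]/((Posz (2 ^ N))%:~R) ler_int; lia.
  have Gle x y : 0 <= x -> x <= y -> y <= 1 -> G x <= G y.
    move=> x0; rewrite le_eqVlt => /orP[/eqP -> //|xy] y1.
    exact/ltW/(pl_mono Gpl x0 xy y1).
  have i0 : 0 <= (Posz i)%:~R / 2 ^+ N :> R by rewrite divr_ge0// ltW.
  have i1 : ((Posz i)%:~R + 1) / 2 ^+ N <= 1 :> R.
    rewrite ler_pdivrMr// mul1r -natrX -[1]/(1%:~R) -rmorphD /=.
    by rewrite -[leRHS]/((Posz (2 ^ N))%:~R) ler_int; lia.
  have ii : (Posz i)%:~R / 2 ^+ N <= ((Posz i)%:~R + 1) / 2 ^+ N :> R.
    by rewrite ler_pM2r ?invr_gt0// lerDl.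
  have Gi : G ((Posz i)%:~R / 2 ^+ N) = j%:~R * 2 ^ m.
    by have := hj 0; rewrite !addr0; apply; rewrite lexx ler01.
  have Gi1 : G (((Posz i)%:~R + 1) / 2 ^+ N) = (j%:~R + 1) * 2 ^ m.
    by apply: hj; rewrite ler01 lexx.
  have j0 : 0 <= j.
    have : 0 <= j%:~R * 2 ^ m :> R by have := Gle _ _ (lexx 0) i0 (le_trans ii i1); rewrite G0 Gi.
    by rewrite pmulr_lge0 ?pow2_gt0// ler0z.
  have j1 : (j%:~R + 1) * 2 ^ m <= 1 :> R.
    by have := Gle _ _ (le_trans i0 ii) i1 (lexx 1); rewrite G1 Gi1.
  have jp : (1 : R) <= j%:~R + 1 by rewrite lerDr ler0z.
  (* The image interval lies in [[0, 1]], so its length 2^m is at most 1 and it is a cell of a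
     standard subdivision. *)
  have m0 : m <= 0.
    rewrite leNgt; apply/negP => m0.
    have [q eq] : exists q : nat, m = q.+1 by exists `|m|.-1%N; lia.
    have : (1 : R) < 2 ^ m by rewrite eq -[2 ^ _]/(2 ^+ q.+1) exprn_egt1// ltr1n.
    move: (pow2_gt0 R m) => p0; nra.
  have [q em] : exists q : nat, m = - q%:Z by exists `|m|%N; lia.
  have [j' ej] : exists j' : nat, j = j' by exists `|j|%N; lia.
  subst m j; rewrite -invr_expz -[2 ^ _]/(2 ^+ q) in Gi Gi1 hj j1.
  have pq : 0 < (2 : R) ^+ q by rewrite exprn_gt0.
  exists (u.1 + u.2 * (j'%:R / 2 ^+ q), u.2 / 2 ^+ q), q; split.
  - move=> s s01 /=; rewrite -!addrA.
    have e x l : u.2 * (x / 2 ^+ l) + u.2 / 2 ^+ l * s = u.2 * ((x + s) / 2 ^+ l).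
      by field; rewrite expf_neq0.
    by rewrite !e (is_lift_tc _ hF) GF (hj s s01).
  - by rewrite /= GF Gi.
  - rewrite /= -!addrA.
    have e x l : u.2 * (x / 2 ^+ l) + u.2 / 2 ^+ l = u.2 * ((x + 1) / 2 ^+ l).
      by field; rewrite expf_neq0.
    by rewrite !e GF Gi1.
  - apply: desc_grid; move: j1; rewrite ler_pdivrMr// mul1r -natrX.
    by rewrite natr1 ler_nat.
rewrite Fa Fb in h2; have [t et] := chain_cells u0 h3 h2.
by exists (full N), t; rewrite -et.
Qed.

(** The elements of T supported in [u] form a copy of F; generators at [u] and [rc u] play the roles
    of x_0 and x_1. *)
Lemma supp_generated (P : set (homeo (circle R))) u f : is_subgroup P ->
  dcell u -> (exists2 x, P x & is_gen u x) -> (exists2 x, P x & is_gen (rc u) x) ->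
  thompsonT f -> supp f u -> P f.
Proof.
move=> Pg du x0 x1 Tf sf; have [s [t h]] := supp_trees du Tf sf.
exact: trees_generated Pg (dcell_small du) x0 x1 _ _ _ sf h.
Qed.

End DyadicTrees.

(** * The pentagon relation *)

Section GroupLemmas.
Local Open Scope group_scope.
Variable G : groupType.
Implicit Types x y z w : G.

(** Up to order both products equal a product of [x] and [z] times [y * w], which commutes with
    everything and cancels. *)
Lemma commg_disjoint x y z w : commute y z -> commute y w -> commute w x ->
  commute y x -> commute w z -> [~ x * y, z * w] = [~ x, z].
Proof.
move=> yz yw wx yx wz.
have comE (u v : G) : [~ u, v] = (v * u)^-1 * (u * v).
  by rewrite commgEl conjgE invgM -!mulgA.
have e1 : x * y * (z * w) = x * z * (y * w) by rewrite -!mulgA (mulgA y) yz -!mulgA.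
have e2 : z * w * (x * y) = z * x * (y * w) by rewrite yw -!mulgA (mulgA w) wx -!mulgA.
have cx : commute (y * w) x by apply/commute_sym/commuteM; exact/commute_sym.
have cz : commute (y * w) z by apply/commute_sym/commuteM; exact/commute_sym.
have cc : commute (y * w) ((z * x)^-1 * (x * z)).
  by apply: commuteM; [apply: commuteV|]; apply: commuteM.
rewrite !comE e1 e2 (_ : _ * _ = (y * w)^-1 * ((z * x)^-1 * (x * z) * (y * w))).
  by rewrite -cc mulKg.
by rewrite [(_ * (y * w))^-1]invgM !mulgA.
Qed.

(** Writing [x ^ d] as [x] times a commutator and [x ^ e] as a commutator times [x], two factors [x]
    cancel and one [x] is left between two commutators. *)
Lemma pentagon_commg x d e : x * x = x ^ d * x * x ^ e ->
  x = [~ x, d]^-1 * [~ e, x^-1]^-1.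
Proof.
have -> : x ^ d = x * [~ x, d] by rewrite mulVKg.
have -> : x ^ e = [~ e, x^-1] * x by rewrite commgEr invgK mulgVK.
move: [~ x, d] [~ e, x^-1] => p q.
rewrite -!mulgA => /mulgI e1.
have e2 : 1 * x = p * (x * q) * x by rewrite mul1g {1}e1 !mulgA.
apply: (@mulgI _ p); rewrite mulVKg.
apply: (@mulIg _ q); rewrite mulVg -mulgA; by apply/esym; apply: (@mulIg _ x); rewrite -e2.
Qed.

End GroupLemmas.

(** * Existence of the standard generators and their pentagon relation *)

Section Criterion.
Variable R : realType.
Implicit Types (F G S : R -> R) (a b c d e x y : R) (k m : int) (n : nat).
Implicit Types (f g h q t : homeo (circle R)).
Local Notation cell := (R * R)%type.
Implicit Types (u v w : cell).

Lemma dcell_dyadic u : dcell u -> dyadic u.1 /\ dyadic u.2.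
Proof. by move=> [d1 [n e]]; split=> //; rewrite e; exact: dyadic_exp. Qed.

Lemma dcell_half n : (2 : R) ^ (- (n.+1)%:Z) / 2 = 2 ^ (- (n.+2)%:Z).
Proof. by rewrite -[n.+2]addn1 PoszD opprD expfzDr// exprN1. Qed.

Lemma dcell_rc u : dcell u -> dcell (rc u).
Proof.
move=> du; have [d1 d2] := dcell_dyadic du; have [_ [n e]] := du; split.
  by apply: dyadicD => //; exact: dyadic_half.
by exists n.+1; rewrite /= e dcell_half.
Qed.

Lemma exists_gen u : dcell u -> exists2 f, thompsonT f & is_gen u f.
Proof.
move=> du; have [da dl] := dcell_dyadic du; have /andP[l0 l1] := dcell_small du.
pose a := u.1; pose l := u.2; rewrite -/a -/l in da dl l0 l1.
have dl2 : dyadic (l / 2) by exact: dyadic_half.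
have dl4 : dyadic (l / 4).
  by rewrite (_ : l / 4 = l / 2 / 2); [exact: dyadic_half|field].
(* Slopes 2, 1 and 1/2 carry the pieces of lengths l/4, l/4, l/2 onto pieces of lengths l/2, l/4,
   l/4. *)
pose F x := if x <= a + l / 4 then 2 ^ 1 * x + (- a)
  else if x <= a + l / 2 then 2 ^ 0 * x + l / 4 else 2 ^ (-1) * x + (a + l) / 2.
have E1 x : 2 ^ 1 * x = 2 * x by rewrite expr1z.
have E0 x : 2 ^ 0 * x = x by rewrite expr0z mul1r.
have EN x : 2 ^ (-1) * x = x / 2 by rewrite exprN1 mulrC.
have dd := @dyadicD R.
have Fpl : pl F a (a + l).
  apply: pl_glue; last 1 first.
  - by rewrite E1 ifT ?E0; [field|lra].
  - apply: pl_aff; [by []|by apply: dd|lra|exists 1, (- a); split=> //; exact: dyadicN].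
  apply: pl_glue; last 1 first.
  - by rewrite E0 EN; field.
  - apply: pl_aff; [exact: dd|exact: dd|lra|by exists 0, (l / 4)].
  - apply: pl_aff; [exact: dd|exact: dd|lra|exists (-1), ((a + l) / 2); split=> //].
    by apply: dyadic_half; exact: dd.
have Fa : F a = a by rewrite /F ifT ?E1; [ring|lra].
have Fb : F (a + l) = a + l.
  by rewrite /F !ifF ?EN; [field|apply/negbTE; rewrite -ltNge; lra..].
have [||f [Tf sf ef]] := supported_glue _ _ Fpl Fa Fb; do ?lra.
exists f => //; split=> // s /andP[s0 s1]; rewrite /= -/a -/l.
- have h1 : 0 <= l * s by rewrite mulr_ge0// ltW.
  have h2 : l * s <= l by rewrite ler_piMr// ltW.
  have e : l / 2 / 2 * s = l * s / 4 by field.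
  rewrite e ef; last by apply/andP; split; lra.
  by rewrite /F ifT ?E1; [congr tc; field|lra].
- have h1 : 0 <= l * s by rewrite mulr_ge0// ltW.
  have h2 : l * s <= l by rewrite ler_piMr// ltW.
  have e : l / 2 / 2 * s = l * s / 4 by field.
  have e' : a + l / 2 / 2 = a + l / 4 by field.
  rewrite e e' ef; last by apply/andP; split; lra.
  (* At the left end of a piece [F] is computed by the preceding branch, so this point is treated
     separately. *)
  have [s00|sp] := eqVneq (l * s) 0.
    by rewrite s00 /F ifT ?E1; [congr tc; field|lra].
  have h3 : 0 < l * s by rewrite lt_def sp.
  rewrite /F ifF; last by apply/negbTE; rewrite -ltNge; lra.
  by rewrite ifT ?E0; [congr tc; field|lra].
- have h1 : 0 <= l * s by rewrite mulr_ge0// ltW.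
  have h2 : l * s <= l by rewrite ler_piMr// ltW.
  have e : l / 2 * s = l * s / 2 by field.
  rewrite e ef; last by apply/andP; split; lra.
  rewrite /F ifF; last by apply/negbTE; rewrite -ltNge; lra.
  have [s00|sp] := eqVneq (l * s) 0.
    rewrite s00 ifT ?E0; last by lra.
    have -> : s = 0 by move/eqP: s00; rewrite mulf_eq0 gt_eqF//= => /eqP.
    by congr tc; field.
  have h3 : 0 < l * s by rewrite lt_def sp.
  rewrite ifF; last by apply/negbTE; rewrite -ltNge; lra.
  by rewrite EN; congr tc; field.
Qed.

Lemma supp_lc f u : small u -> supp f (lc u) -> supp f u.
Proof.
by move=> /andP[u0 u1] sf x /andP[x0 x1]; apply: sf; rewrite /=; apply/andP; split; lra.
Qed.

Lemma supp_lc_rc f u : small u -> supp f (lc u) -> caff f (rc u) (rc u).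
Proof.
move=> /andP[u0 u1] sf s /andP[s0 s1].
have h1 : 0 <= u.2 / 2 * s by rewrite mulr_ge0//; lra.
have h2 : u.2 / 2 * s <= u.2 / 2 by rewrite ler_piMr//; lra.
by apply: sf; rewrite /=; apply/andP; split; lra.
Qed.

(* Both sides rotate ((.,.),.),. into .,(.,(.,.)): the pentagon. *)
Lemma is_gen_pentagon u f g h : small u -> is_gen u f -> is_gen (lc u) g ->
  is_gen (rc u) h -> (f * f = g * f * h)%g.
Proof.
move=> su gf gg gh.
have [_ _ _ sf] := gf; have [_ _ _ /(supp_lc su) sg] := gg.
have [_ _ _ /(supp_rc su) sh] := gh.
pose t1 := Node (Node (Node Leaf Leaf) Leaf) Leaf.
pose t2 := Node Leaf (Node Leaf (Node Leaf Leaf)).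
have c1 : caffs (f * f)%g (cells t1 u) (cells t2 u).
  exact: caffs_comp (is_gen_rotate _ _ _ gf) (is_gen_rotate _ _ _ gf).
have c2 : caffs (g * f * h)%g (cells t1 u) (cells t2 u).
  apply: (@caffs_comp _ _ _ _ (cells (Node Leaf (Node (Node Leaf Leaf) Leaf)) u)).
    apply: (@caffs_comp _ _ _ _ (cells (Node (Node Leaf (Node Leaf Leaf)) Leaf) u)).
      apply: (@caffs_cat _ g (cells (Node (Node Leaf Leaf) Leaf) (lc u))
        (cells (Node Leaf (Node Leaf Leaf)) (lc u)) [:: rc u] [:: rc u]).
        exact: is_gen_rotate gg.
      by split=> //; apply: supp_lc_rc => //; have [] := gg.
    exact: is_gen_rotate gf.
  apply: (@caffs_cat _ h [:: lc u] [:: lc u] (cells (Node (Node Leaf Leaf) Leaf) (rc u))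
    (cells (Node Leaf (Node Leaf Leaf)) (rc u))); last exact: is_gen_rotate gh.
  by split=> //; apply: supp_rc_lc => //; have [] := gh.
apply: (supp_eq (suppM sf sf)) => [|p up]; first by do 2?apply: suppM.
have [v vs vp] := cells_cover t1 up.
exact: caffs_eq c1 c2 vs vp.
Qed.

Lemma supportedV f a b : supported f a b -> supported (f^-1)%g a b.
Proof. by move=> sf x hx; rewrite -[in LHS]sf// homeo_invK. Qed.

Lemma supported_or f a b p : a < b -> supported f a b ->
  (exists2 x, a < x < b & p = tc x) \/ f p = p.
Proof.
move=> ab sf; have [x /andP[x0 x1] <-] := tc_rep a p.
have [bx|xb] := leP b x; first by right; apply: sf; rewrite bx ltW.
move: x0; rewrite le_eqVlt => /orP[/eqP <-|x0]; last by left; exists x; rewrite ?x0.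
have [ba|ba] := leP b (a + 1); last by left; exists (a + 1); [lra|rewrite -(tc_shift a 1)].
by right; rewrite -(tc_shift a 1); apply: sf; rewrite ba lexx.
Qed.

End Criterion.

(** * A criterion for generating T *)

Lemma tc_disjoint (R : realType) (a b x y : R) :
  a < x < b -> b <= y <= a + 1 -> tc x <> tc y.
Proof.
move=> /andP[x0 x1] /andP[y0 y1] /tc_eq[m em].
have n1 : (- 1)%:~R < m%:~R :> R by rewrite rmorphN /=; lra.
have n2 : m%:~R < 0 :> R by lra.
by rewrite ltr_int in n1; rewrite ltrz0 in n2; lia.
Qed.

Section Criterion.
Variable R : realType.
Implicit Types (F G S : R -> R) (a b c d e x y : R) (k m : int) (n : nat).
Implicit Types (f g h q : homeo (circle R)).
Local Notation cell := (R * R)%type.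
Implicit Types (u v w : cell).

(** [Hext] says that every element of F on [X] is the restriction of an element of [H]. The
    inequalities on the lift [T] say that [t] maps the closed complement of [X] into the interior of
    [X]. *)
Variables (H : set (homeo (circle R))) (X : cell) (t : homeo (circle R)) (T : R -> R).
Hypotheses (Hgrp : is_subgroup H) (HT : H `<=` @thompsonT R) (dX : dcell X).
Hypothesis Hext : forall f, thompsonT f -> supp f X ->
  exists2 h, H h & forall p, incell X p -> h p = f p.
Hypotheses (Ht : H t) (hT : is_lift T t).
Hypotheses (T0 : X.1 < T (X.1 + X.2)) (T1 : T (X.1 + 1) < X.1 + X.2).

Let H1 : H 1%g. Proof. by case: Hgrp. Qed.
Let HM f g : H f -> H g -> H (f * g)%g. Proof. by case: Hgrp => _ h _; exact: h. Qed.
Let HV f : H f -> H (f^-1)%g. Proof. by case: Hgrp => _ _; exact. Qed.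
Let HJ f g : H f -> H g -> H (f ^ g)%g.
Proof. by move=> Hf Hg; exact: HM (HV Hg) (HM Hf Hg). Qed.

Let a := X.1.
Let e := X.1 + X.2.
Let aea : a < e /\ e < a + 1.
Proof. by have /andP[? ?] := dcell_small dX; rewrite /a /e; split; lra. Qed.
Let da : dyadic a. Proof. by have [] := dcell_dyadic dX. Qed.
Let de : dyadic e. Proof. by have [? ?] := dcell_dyadic dX; exact: dyadicD. Qed.

Let incellP x : a <= x <= e -> incell X (tc x).
Proof.
move=> /andP[x0 x1]; have /andP[X0 _] := dcell_small dX.
exists ((x - X.1) / X.2).
  by apply/andP; split; [rewrite divr_ge0// ?subr_ge0// ltW|rewrite ler_pdivrMr// mul1r lerBlDl].
by congr tc; rewrite mulrC divfK ?gt_eqF// addrC subrK.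
Qed.

(** An element of [H] can be prescribed on an arc inside [X]. The element [f] is kept in the
    conclusion because it shows that [h] preserves [X]. *)
Let extend_X c d S : pl S c d -> a < c -> a < S c -> d < e -> S d < e ->
  exists h f, [/\ H h, thompsonT f, supp f X, forall p, incell X p -> h p = f p
    & forall x, c <= x <= d -> h (tc x) = tc (S x)].
Proof.
have [ae ea] := aea.
move=> hS ac aSc de1 de2.
have [f [Tf sf ef]] := extend_in da de ea hS ac aSc de1 de2.
have [h Hh hf] := Hext Tf sf.
exists h, f; split=> // x xcd; rewrite hf ?ef//; apply: incellP.
by move: xcd => /andP[? ?]; apply/andP; split; lra.
Qed.

Let Tt : thompsonT t := HT Ht.
Let Tm : {mono T : x y / x < y} := is_lift_mono hT.
Let TmW : {mono T : x y / x <= y} := is_lift_monoW hT.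
Let T0' : a < T e := T0.
Let T1' : T (a + 1) < e := T1.

Let outP p : ~ incell X p -> exists2 x, e <= x < a + 1 & p = tc x.
Proof. by move=> np; have [//|] := cell_or_out X p. Qed.

Let supported_X f c d : a < c -> d < e -> supported f c d -> supp f X.
Proof.
have [ae ea] := aea.
move=> ac de' sf x /andP[x0 x1]; apply: sf.
by rewrite -/a -/e in x0 x1 *; apply/andP; split; lra.
Qed.

(** Just to the right of the left end of [X], [t] still maps into [X]; there an element [h] of [H]
    can undo it. Since [h] preserves [X], the product [t * h] still moves the complement into
    [X]. *)
Lemma identity_inside_displacing_outside : exists c1 c2 q,
  [/\ dyadic c1, dyadic c2, [/\ a < c1, c1 < c2 & c2 < e], H q
    & (forall x, c1 <= x <= c2 -> q (tc x) = tc x) /\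
      (forall p, ~ incell X p -> incell X (q p))].
Proof.
have [ae ea] := aea.
have [Tp _ _] := hT.
have ae1 : a + 1 < e + 1 by rewrite ltrD2r.
have [d d0 hd] := is_lift_right Tt hT T1' ae1.
have ad : a < Num.min (a + d) e by rewrite lt_min ae ltrDl d0.
have m1 : Num.min (a + d) e <= a + d by rewrite ge_min lexx.
have m2 : Num.min (a + d) e <= e by rewrite ge_min lexx orbT.
have [c1 dc1 /andP[c10 c11]] := dyadic_between ad.
have [c2 dc2 /andP[c20 c21]] := dyadic_between c11.
have [Ti [hTi TK TiK]] := is_lift_inv Tt hT.
have lo c : a < c -> a < T (c + 1).
  by move=> ac; apply: lt_trans T0' _; rewrite Tm; lra.
have hi c : a < c -> c < a + d -> T (c + 1) < e.
  move=> ac cd; have cad : a + 1 <= c + 1 <= a + 1 + d by apply/andP; split; lra.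
  by have [] := hd _ cad.
have dT c : dyadic c -> dyadic (T (c + 1)).
  by move=> dc; apply/(is_lift_dyadic _ Tt hT); apply: dyadicD => //; exact: dyadic1.
(* The shift by -1 makes this lift of the inverse send [T (c + 1)] back to [c]. *)
have hS := is_lift_shift (- 1) hTi.
have Spl := is_lift_pl (thompsonTV Tt) hS (dT _ dc1) (dT _ dc2).
have [||||| h [f [Hh Tf sf hf hS']]] := extend_X (Spl _); rewrite ?TK.
- by rewrite Tm ltrD2r.
- by apply: lo; lra.
- by rewrite rmorphN addrK; lra.
- by apply: hi; lra.
- by rewrite rmorphN addrK; lra.
exists c1, c2, (t * h)%g; split=> //; first by split=> //; lra.
- exact: HM.
split=> [x /andP[x0 x1]|p /outP[x /andP[x0 x1] ->]].
  rewrite homeoME -(tc_shift x 1) (is_lift_tc _ hT) hS'.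
    by rewrite TK rmorphN addrK tc_shift.
  by rewrite !TmW !lerD2r x0.
rewrite homeoME (is_lift_tc _ hT).
have xX : incell X (tc (T x)).
  apply: incellP; apply/andP; split; apply: ltW.
    by apply: lt_le_trans T0' _; rewrite TmW.
  by apply: lt_trans T1'; rewrite Tm.
by rewrite hf//; exact: supp_incell.
Qed.

(** Extensions in [H] differ from [f] and [g] only by factors that are trivial on [X]. Conjugating
    one of them by [q] makes the supports of these factors disjoint, so they drop out of the
    commutator. *)
Lemma commutators_supported : exists c1 c2,
  [/\ dyadic c1, dyadic c2, [/\ a < c1, c1 < c2 & c2 < e] &
    forall f g, thompsonT f -> thompsonT g -> supported f c1 c2 ->
      supported g c1 c2 -> H [~ f, g]%g].
Proof.
have [ae ea] := aea.
have [c1 [c2 [q [dc1 dc2 [ac cc ce] Hq [qC qX]]]]] := identity_inside_displacing_outside.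
exists c1, c2; split=> // f1 f2 Tf1 Tf2 s1 s2.
have Cor := supported_or _ cc.
have CX x : c1 < x < c2 -> incell X (tc x).
  by move=> /andP[x0 x1]; apply: incellP; apply/andP; split; lra.
have sX1 := supported_X ac ce s1; have sX2 := supported_X ac ce s2.
have [h1 Hh1 e1] := Hext Tf1 sX1; have [h2 Hh2 e2] := Hext Tf2 sX2.
pose k1 := (f1^-1 * h1)%g; pose k2 := (f2^-1 * h2)%g.
have fixX f h p : supp f X -> (forall p, incell X p -> h p = f p) ->
    incell X p -> (f^-1 * h)%g p = p.
  move=> sf ef Xp; rewrite homeoME ef ?homeo_Kinv//.
  by apply: supp_incell Xp; exact: suppV.
have k1X p : incell X p -> k1 p = p by exact: fixX.
have k2X p : incell X p -> k2 p = p by exact: fixX.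
have Eh1 : h1 = (f1 * k1)%g by rewrite mulVKg.
have Eh2 : h2 = (f2 * k2)%g by rewrite mulVKg.
clearbody k1 k2.
(* [q] is the identity on the support of [f2]. *)
have f2q : (f2 ^ q = f2)%g.
  rewrite /conjg (_ : f2 * q = q * f2)%g ?mulKg//.
  apply: disjoint_commute => p; have [[x /andP[x0 x1] ->]|] := Cor f2 p s2; last by left.
  by right; apply: qC; rewrite !ltW.
pose k2' := (k2 ^ q)%g.
have k2out p : incell X ((q^-1)%g p) -> k2' p = p.
  by move=> Xp; apply: conjg_fixed; exact: k2X.
have k2C x : c1 < x < c2 -> k2' (tc x) = tc x.
  move=> xc; apply: k2out; have /andP[x0 x1] := xc.
  have xc' : c1 <= x <= c2 by rewrite !ltW.
  by have := homeo_invK q (tc x); rewrite qC// => ->; exact: CX.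
have k1orC f p : supported f c1 c2 -> k1 p = p \/ f p = p.
  by move=> sf; have [[x hx ->]|] := Cor f p sf; [left; apply/k1X/CX|right].
have k2orC f p : supported f c1 c2 -> k2' p = p \/ f p = p.
  by move=> sf; have [[x hx ->]|] := Cor f p sf; [left; apply/k2C|right].
have -> : [~ f1, f2]%g = [~ h1, h2 ^ q]%g.
  rewrite Eh1 Eh2 conjMg f2q commg_disjoint//; apply: disjoint_commute => p.
  - exact: k1orC.
  (* If [q] brings [p] from outside [X], then [p] is in [X], where [k1] is trivial; otherwise the
     conjugate of [k2] fixes [p]. *)
  - have [Xp|nXp] := pselect (incell X ((q^-1)%g p)); first by right; exact: k2out.
    by left; apply: k1X; have := qX _ nXp; rewrite homeo_Kinv.
  - exact: k2orC.
  - exact: k1orC.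
  - exact: k2orC.
have HJ2 : H (h2 ^ q)%g by exact: HJ.
exact: HM (HV Hh1) (HJ Hh1 HJ2).
Qed.

(** The generators of the halves of a cell are conjugate to the generator of the cell by elements
    supported in [[c1, c2]]. The pentagon then writes the generator as a product of inverses of
    commutators covered by [Hcomm]. *)
Lemma gen_in_H : exists2 v, dcell v /\ (a < v.1 /\ v.1 + v.2 < e) &
  forall f, thompsonT f -> supp f v -> H f.
Proof.
have [ae ea] := aea.
have [c1 [c2 [dc1 dc2 [ac cc ce] Hcomm]]] := commutators_supported.
have c2c1 : c2 < c1 + 1 by lra.
have gen v : dcell v -> c1 < v.1 -> v.1 + v.2 < c2 -> exists2 x, H x & is_gen v x.
  move=> dv c1v vc2; have [dv1 dv2] := dcell_dyadic dv.
  have sv := dcell_small dv; have /andP[v0 v1] := sv.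
  have [x Tx gx] := exists_gen dv; exists x => //.
  (* The affine map of slope 1/2 from [v] to a half [w], extended within [(c1, c2)]. *)
  have scale w : dyadic w.1 -> c1 < w.1 -> w.1 + w.2 < c2 -> w.2 = v.2 / 2 ->
      exists q, [/\ thompsonT q, supported q c1 c2 & caff q v w].
    move=> dw c1w wc2 ew.
    pose S y : R := 2 ^ (- 1) * y + (w.1 - v.1 / 2).
    have ES y : S y = y / 2 + (w.1 - v.1 / 2) by rewrite /S exprN1 mulrC.
    have Spl : pl S v.1 (v.1 + v.2).
      apply: pl_aff => //; [exact: dyadicD|lra|exists (- 1), (w.1 - v.1 / 2)].
      by split=> //; apply: dyadicB => //; exact: dyadic_half.
    have [|||| d [Td sd ed]] := extend_in dc1 dc2 c2c1 Spl; rewrite ?ES; do ?lra.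
    exists d; split=> // s /andP[s0 s1].
    have h1 : 0 <= v.2 * s by rewrite mulr_ge0// ltW.
    have h2 : v.2 * s <= v.2 by rewrite ler_piMr// ltW.
    rewrite ed; last by apply/andP; split; lra.
    by rewrite ES ew; congr tc; field.
  have [||||d [Td sd cd]] := scale (lc v); rewrite /=; do ?[by []|lra].
  have [||||d' [Td' sd' cd']] := scale (rc v); rewrite /=; do ?[by []|lra].
    by apply: dyadicD => //; exact: dyadic_half.
  have sx : supported x c1 c2.
    have [_ _ _ s] := gx; move=> y /andP[y0 y1]; apply: s.
    by apply/andP; split; lra.
  have := is_gen_pentagon sv gx (is_gen_conj sv (small_lc sv) gx cd)
    (is_gen_conj sv (small_rc sv) gx cd').
  move=> /pentagon_commg ->; apply: HM; apply: HV; apply: Hcomm => //.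
    exact: thompsonTV.
  exact: supportedV.
have [v1 dv1 /andP[v10 v11]] := dyadic_between cc.
have c2v1 : 0 < c2 - v1 by rewrite subr_gt0.
have [n hn] := small_pow2 c2v1.
pose v : cell := (v1, 2 ^ (- n.+1%:Z)).
have v2n : v.2 < 2 ^- n.
  rewrite /= -invr_expz ltf_pV2 ?posrE ?exprz_gt0 ?exprn_gt0//.
  by rewrite -[2 ^ _]/(2 ^+ n.+1) ltr_eXn2l ?ltr1n.
have dv : dcell v by split=> //; exists n.
have v20 : 0 < v.2 by exact: pow2_gt0.
have ev1 : v.1 = v1 by [].
clearbody v; subst v1.
have vc : v.1 + v.2 < c2 by lra.
exists v; first by split=> //; split; lra.
move=> f Tf sf; apply: (supp_generated Hgrp dv _ _ Tf sf); first by apply: gen.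
apply: gen; first exact: dcell_rc.
  by rewrite /=; lra.
by rewrite /= (_ : _ + _ = v.1 + v.2)//; field.
Qed.

(** First blow [[x0, x1]] up to an arc [[a1, e1]] so large that [t] still maps its complement into
    [X]; apply [t]; then squeeze the image of the complement into [(y0, y1)]. *)
Lemma compress x0 x1 y0 y1 : dyadic x0 -> dyadic x1 -> dyadic y0 -> dyadic y1 ->
  a < x0 -> x0 < x1 -> x1 < e -> a < y0 -> y0 < y1 -> y1 < e ->
  exists2 q, H q & forall p, (exists2 x, x0 <= x <= x1 & p = tc x) \/
    (exists2 y, y0 < y < y1 & q p = tc y).
Proof.
have [ae ea] := aea; have [Tp _ _] := hT.
move=> dx0 dx1 dy0 dy1 ax0 x01 x1e ay0 y01 y1e.
have [z1 Tz1] := is_lift_surj a Tt hT; have [z2 Tz2] := is_lift_surj e Tt hT.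
have z1e : z1 < e by rewrite -Tm Tz1.
have z2a : a + 1 < z2 by rewrite -Tm Tz2.
have m1 : a <= Num.max z1 a by rewrite le_max lexx orbT.
have m2 : z1 <= Num.max z1 a by rewrite le_max lexx.
have m3 : Num.max z1 a < e by rewrite gt_max z1e.
(* Taking [e1] beyond [z1] and [a1 + 1] before [z2] keeps [T e1] and [T (a1 + 1)] strictly between
   [a] and [e]. *)
have [e1 de1 /andP[e10 e11]] := dyadic_between m3.
have m4 : a < Num.min e1 (z2 - 1) by rewrite lt_min; apply/andP; split; lra.
have m5 : Num.min e1 (z2 - 1) <= e1 by rewrite ge_min lexx.
have m6 : Num.min e1 (z2 - 1) <= z2 - 1 by rewrite ge_min lexx orbT.
have [a1 da1 /andP[a10 a11]] := dyadic_between m4.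
have a1e1 : a1 < e1 by lra.
have [S1 [S1pl S1x0 S1x1]] := pl_interp dx0 dx1 da1 de1 x01 a1e1.
have [||||h1 [_ [Hh1 _ _ _ eh1]]] := extend_X S1pl; rewrite ?S1x0 ?S1x1//.
have Te1 : a < T e1 by rewrite -Tz1 Tm; lra.
have Ta1 : T (a1 + 1) < e by rewrite -Tz2 Tm; lra.
have Te1a1 : T e1 < T (a1 + 1) by rewrite Tm; lra.
have dTe1 : dyadic (T e1) by apply/(is_lift_dyadic _ Tt hT).
have dTa1 : dyadic (T (a1 + 1)).
  by apply/(is_lift_dyadic _ Tt hT); apply: dyadicD => //; exact: dyadic1.
have [S2 [S2pl S2l S2r]] := pl_interp dTe1 dTa1 dy0 dy1 Te1a1 y01.
have [||||h2 [_ [Hh2 _ _ _ eh2]]] := extend_X S2pl; rewrite ?S2l ?S2r//.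
exists (h1 * t * h2)%g; first by apply: HM => //; exact: HM.
move=> p; have [z /andP[z0 z1'] ez] := tc_rep a1 (h1 p).
have [ze|ez1] := leP z e1; [left|right].
  have [|x xw Sx] := pl_surj S1pl (y := z); first by rewrite S1x0 S1x1 z0.
  by exists x => //; apply: (@homeo_inj _ h1); rewrite eh1// Sx.
have tz0 : T e1 < T z by rewrite Tm.
have tz1 : T z < T (a1 + 1) by rewrite Tm.
exists (S2 (T z)); last by rewrite !homeoME -ez (is_lift_tc _ hT) eh2// !ltW.
have s0 : y0 < S2 (T z) by rewrite -S2l (pl_mono S2pl)// ltW.
have s1 : S2 (T z) < y1 by rewrite -S2r (pl_mono S2pl)// ltW.
by rewrite s0 s1.
Qed.

Lemma generation_criterion f : thompsonT f -> H f.
Proof.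
have [ae ea] := aea.
move=> Tf; have [v [dv [av ve]] Hv] := gen_in_H.
have [dv1 dv2] := dcell_dyadic dv; have /andP[v0 v1] := dcell_small dv.
have [Tp _ _] := hT.
have [x0 dx0 /andP[ax0 x0e]] := dyadic_between ae.
(* The image of [x0] is brought into the interior of [X]: [s] is trivial if it is already there, and
   [t] otherwise. *)
have [s [Hs [y1 [ay1 y1e] fy1]]] : exists s, H s /\
    exists2 y1, a < y1 /\ y1 < e & (f * s)%g (tc x0) = tc y1.
  have [y /andP[y0 y1] ey] := tc_rep a (f (tc x0)).
  have tX z : e <= z <= a + 1 -> a < T z < e.
    move=> /andP[z0 z1]; apply/andP; split.
      by apply: lt_le_trans T0' _; rewrite TmW.
    by apply: le_lt_trans T1'; rewrite TmW.
  move: y0; rewrite le_eqVlt => /orP[/eqP ya|ya].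
    exists t; split=> //; exists (T (a + 1)).
      by apply/andP/tX; rewrite lexx ltW.
    by rewrite homeoME -ey -ya -(tc_shift a 1) (is_lift_tc _ hT).
  have [ye|ey'] := ltP y e; first by exists 1%g; split=> //; exists y.
  exists t; split=> //; exists (T y); first by apply/andP/tX; rewrite ey' ltW.
  by rewrite homeoME -ey (is_lift_tc _ hT).
have Tg : thompsonT (f * s)%g by apply: thompsonTM => //; exact: HT.
have [G hG Gx0] := is_lift_at Tg fy1.
have Gx0e : G x0 < e by rewrite Gx0.
have [d d0 hd] := is_lift_right Tg hG Gx0e x0e.
have [x1 dx1 /andP[x01 x1d]] : exists2 x1, dyadic x1 & x0 < x1 < x0 + d.
  by apply: dyadic_between; rewrite ltrDl.
have [Gx1e x1e] : G x1 < e /\ x1 < e by apply: hd; rewrite !ltW.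
have [h [f0 [Hh Tf0 sf0 hf0 hG0]]] := extend_X (is_lift_pl Tg hG dx0 dx1 x01)
  ax0 (eq_ind_r (fun z => a < z) ay1 Gx0) x1e Gx1e.
pose f' := (f * s * h^-1)%g.
have f'w x : x0 <= x <= x1 -> f' (tc x) = tc x.
  by move=> xw; rewrite homeoME (is_lift_tc _ hG) -hG0// homeo_invK.
suff Hf' : H f'.
  have -> : f = (f' * h * s^-1)%g by rewrite /f' mulgVK mulgK.
  by apply: HM; [exact: HM|exact: HV].
have vv : v.1 < v.1 + v.2 by rewrite ltrDl.
have dve : dyadic (v.1 + v.2) by exact: dyadicD.
have [q Hq hq] := compress dx0 dx1 dv1 dve ax0 x01 x1e av vv ve.
have Tf' : thompsonT f'.
  by apply: thompsonTM => //; apply: thompsonTV; exact: HT.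
(* [f'] is the identity on [[x0, x1]], and [q] maps everything else into [v], so [f' ^ q] is
   supported in [v]. *)
have -> : f' = ((f' ^ q) ^ q^-1)%g by rewrite conjgK.
apply: HJ; last exact: HV.
apply: Hv; first by apply: thompsonTJ => //; exact: HT.
move=> y /andP[y0 y1']; apply: conjg_fixed.
have [[x xw ->]|[z /andP[z0 z1]]] := hq ((q^-1)%g (tc y)); first exact: f'w.
rewrite homeo_Kinv => yz; exfalso; apply: (@tc_disjoint _ v.1 (v.1 + v.2) z y) => //.
  by rewrite z0.
by rewrite y0.
Qed.

End Criterion.

(** * Dynamics of elements of infinite order *)

Section Dynamics.
Variable R : realType.
Implicit Types (F G : R -> R) (a b c d x y z : R) (k m : int) (n : nat).
Implicit Types (f g h : homeo (circle R)).

Lemma is_lift_iter F f n : is_lift F f -> is_lift (iter n F) (f ^+ n)%g.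
Proof.
move=> hF; elim: n => [|n ih]; first exact: is_lift1.
by rewrite expgSr; exact: is_lift_comp ih hF.
Qed.

(** Suppose all dyadic points are fixed but [x] moves to [y] in [(x, x + 1)]. Dyadic points [d] in
    [(x, y)] and [c] in [(y, x + 1)] give [d + 1 <= F d < F c <= c], contradicting [c < d + 1]. *)
Lemma moved_dyadic f : thompsonT f -> f <> 1%g ->
  exists2 x, dyadic x & f (tc x) <> tc x.
Proof.
move=> Tf nf; apply: contrapT => nex; apply: nf; apply: homeo_ext_tc => x.
have fd d : dyadic d -> f (tc d) = tc d.
  by move=> dd; apply: contrapT => nd; apply: nex; exists d.
have [y /andP[]] := tc_rep x (f (tc x)).
rewrite le_eqVlt => /orP[/eqP <- _ <-//|xy yx1 ey].
have [F hF Fx] := is_lift_at Tf (esym ey).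
have [Fp Fm _] := hF.
have [d dd /andP[d0 d1]] := dyadic_between xy.
have [c dc /andP[c0 c1]] := dyadic_between yx1.
have sd : tc (F d) = tc d by rewrite -(is_lift_tc _ hF) fd.
have sc : tc (F c) = tc c by rewrite -(is_lift_tc _ hF) fd.
have [m em] := tc_eq sd; have [j ej] := tc_eq sc.
have h1 : y < F d by rewrite -Fx Fm.
have h2 : F d < F c by rewrite Fm//; lra.
have h3 : F c < y + 1 by rewrite -Fx -Fp Fm//; lra.
have m0 : (0 : R) < m%:~R by lra.
have j0 : j%:~R < 1 :> R by lra.
rewrite ltr0z in m0; rewrite ltrz1 in j0.
have m1 : 1 <= m%:~R :> R by rewrite ler1z -gtz0_ge1.
have j1 : j%:~R <= 0 :> R by rewrite lerz0 -ltzD1 add0r.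
by exfalso; lra.
Qed.

Lemma sort3 (Q : R -> Prop) x y z : Q x -> Q y -> Q z -> x <> y -> y <> z -> x <> z ->
  exists x' y' z', [/\ Q x', Q y', Q z', x' < y' & y' < z'].
Proof.
wlog xy : x y / x < y => [hw|] Qx Qy Qz.
  move=> nxy nyz nxz; have [xy|xy|//] := ltgtP x y; first exact: hw Qx Qy Qz _ _ _.
  by apply: (hw y x) => // /esym.
move=> _ nyz nxz; have [yz|zy|//] := ltgtP y z; first by exists x, y, z.
by have [xz|zx|//] := ltgtP x z; [exists x, z, y|exists z, x, y].
Qed.

Definition translate_of f x y := exists n F, [/\ is_lift F (f ^+ n)%g, F x = y & x < y < x + 1].

Lemma three_translates f : thompsonT f -> infinite_order f ->
  exists x y1 y2 y3, [/\ dyadic x, translate_of f x y1, translate_of f x y2,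
    translate_of f x y3 & y1 < y2 /\ y2 < y3].
Proof.
(* The exponent 6 is the least common multiple of 1, 2, 3: a point moved by [f ^+ 6] is moved by
   [f], [f ^+ 2] and [f ^+ 3], so its first three translates are distinct. *)
move=> Tf of'; have [x dx fx] := moved_dyadic (thompsonTX 6 Tf) (of' 6%N isT).
have nfix n j : (n * j = 6)%N -> (f ^+ n)%g (tc x) <> tc x.
  move=> nj fn; apply: fx; rewrite -nj expgnA.
  by elim: j {nj} => [|j ih]; rewrite ?expg0// expgSr homeoME ih.
have tr n j : (n * j = 6)%N -> exists2 y, tc y = (f ^+ n)%g (tc x) & translate_of f x y.
  move=> nj; have [y /andP[]] := tc_rep x ((f ^+ n)%g (tc x)).
  rewrite le_eqVlt => /orP[/eqP xy _ ey|xy yx ey].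
    by case: (nfix n j nj); rewrite -ey -xy.
  have [F hF Fx] := is_lift_at (thompsonTX n Tf) (esym ey).
  by exists y => //; exists n, F; split=> //; rewrite xy.
have [u eu tu] := tr 1%N 6%N erefl; have [v ev tv] := tr 2%N 3%N erefl.
have [w ew tw] := tr 3%N 2%N erefl.
have diff n : (f ^+ n)%g (f (tc x)) = (f ^+ n)%g (tc x) -> False.
  by move=> /homeo_inj; exact: (nfix 1%N 6%N erefl).
have uv : u <> v.
  by move=> e; move: eu; rewrite e ev expg1 expgS expg1 homeoME => /homeo_inj/(nfix 1%N 6%N erefl).
have vw : v <> w.
  by move=> e; move: ev; rewrite e ew => /esym; rewrite [(f ^+ 3)%g]expgS homeoME => /esym/diff.
have uw : u <> w.
  move=> e; move: eu; rewrite e ew expg1 expgSr homeoME => /homeo_inj.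
  exact: (nfix 2%N 3%N erefl).
have [y1 [y2 [y3 [t1 t2 t3 y12 y23]]]] := sort3 tu tv tw uv vw uw.
by exists x, y1, y2, y3.
Qed.

(** * Rational approximation of the rotation number *)

Lemma dirichlet (L : nat) (P : int) : (0 < L)%N -> exists n (m : int), [/\ (0 < n <= 8)%N,
  - L%:Z < 8 * (n%:Z * P - L%:Z * m) & 8 * (n%:Z * P - L%:Z * m) < L%:Z].
Proof.
(* Pigeonhole: nine multiples of [P] modulo [L] fall into eight boxes of length [L] / 8. *)
move=> L0; pose r (i : 'I_9) := ((i%:Z * P) %% L%:Z)%Z.
have r0 i : 0 <= r i by apply: modz_ge0; lia.
have r1 i : r i < L%:Z by apply: ltz_pmod; lia.
have bin (i : 'I_9) : ((8 * absz (r i)) %/ L < 8)%N.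
  by rewrite ltn_divLR//; have := r0 i; have := r1 i; lia.
pose B (i : 'I_9) : 'I_8 := Ordinal (bin i).
have : ~~ injectiveb B.
  by apply/negP => /injectiveP/leq_card; rewrite !card_ord.
move=> /injectivePn[i [j nij eB]].
wlog ij : i j nij eB / (i < j)%N => [hw|].
  have [ij|ji|eij] := ltngtP i j; first exact: hw ij.
    by apply: (hw j i) => //; rewrite eq_sym.
  by case/eqP: nij; apply/val_inj.
have {}eB : ((8 * absz (r i)) %/ L = (8 * absz (r j)) %/ L)%N by case: eB.
have di := divz_eq (i%:Z * P) L%:Z; have dj := divz_eq (j%:Z * P) L%:Z.
have jl : (j < 9)%N by exact: ltn_ord.
have h1 := divn_eq (8 * absz (r i)) L; have h2 := divn_eq (8 * absz (r j)) L.
have l1 := ltn_pmod (8 * absz (r i)) L0; have l2 := ltn_pmod (8 * absz (r j)) L0.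
rewrite -/(r i) in di; rewrite -/(r j) in dj; rewrite eB in h1.
have := r0 i; have := r0 j; move: di dj h1 h2 l1 l2.
move: (r i) (r j) (_ %% L)%N (_ %% L)%N (_ %/ L)%N => ri rj si sj q.
move: (divz (i%:Z * P) L) (divz (j%:Z * P) L) => qi qj.
move: (nat_of_ord i) (nat_of_ord j) ij jl => {B bin eB nij r r0 r1 i j}.
move=> i j ij jl di dj h1 h2 l1 l2 rj0 ri0.
exists (j - i)%N, (qj - qi).
have -> : (j - i)%N%:Z * P - L%:Z * (qj - qi) = rj - ri.
  by rewrite -subzn ?(ltnW ij)// mulrBl di dj; ring.
split; first by apply/andP; split; lia.
  by lia.
by lia.
Qed.

Lemma iter_ge F x (c : int) n : {homo F : x y / x < y} -> periodic1 F ->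
  x + c%:~R <= F x -> x + (n%:Z * c)%:~R <= iter n F x.
Proof.
move=> Fm Fp h; elim: n => [|n ih]; first by rewrite mul0r addr0.
apply: le_trans (_ : F (x + (n%:Z * c)%:~R) <= _); last by rewrite /= homo_lt_mono_le.
by rewrite periodicz// -addn1 PoszD mulrDl mul1r rmorphD/=; lra.
Qed.

Lemma iter_le F x (c : int) n : {homo F : x y / x < y} -> periodic1 F ->
  F x <= x + c%:~R -> iter n F x <= x + (n%:Z * c)%:~R.
Proof.
move=> Fm Fp h; elim: n => [|n ih]; first by rewrite mul0r addr0.
apply: le_trans (_ : _ <= F (x + (n%:Z * c)%:~R)) _; first by rewrite /= homo_lt_mono_le.
by rewrite periodicz// -addn1 PoszD mulrDl mul1r rmorphD/=; lra.
Qed.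

(** Multiplied by [n], both bounds compare [n * P] with [L * m] up to 840. The error is below [L] /
    8 = 735, which leaves room for the terms [n] and [2 * n], at most 16. *)
Lemma rotation_arith (n q L : nat) (m P : int) : (n * q = 840)%N -> L = (7 * 840)%N ->
  (0 < n <= 8)%N -> - L%:Z < 8 * (n%:Z * P - L%:Z * m) ->
  8 * (n%:Z * P - L%:Z * m) < L%:Z ->
  q%:Z * (7 * m - 1) <= P - 1 /\ P + 2 <= q%:Z * (7 * m + 1).
Proof.
move=> nq eL /andP[n0 n8] h1 h2.
have nqz : n%:Z * q%:Z = 840 by lia.
have Lm : L%:Z * m = 7 * (840 * m) by rewrite eL PoszM -mulrA.
have n0' : 0 < n%:Z :> int by lia.
move: h1 h2; rewrite Lm eL PoszM => h1 h2.
split; rewrite -(ler_pM2l n0') mulrA nqz mulrDr ?mulrBr; lia.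
Qed.

(* With L large, P / L approximates the rotation number of F, and the rotation
   number of F^n - m is less than 1/7 in absolute value. *)
Lemma small_rotation F f : is_lift F f -> exists n (m : int), (0 < n)%N /\
  forall x, x - 1 < iter (7 * n) F x - (7 * m)%:~R < x + 1.
Proof.
move=> hF; have [L eL] : exists L, L = (7 * 840)%N by exists (7 * 840)%N.
pose P := Num.floor (iter L F 0).
have L0 : (0 < L)%N by lia.
have [n [m [/andP[n0 n8] h1 h2]]] := dirichlet P L0.
(* 840 is the least common multiple of 1 to 8, so every possible [n] divides it, and [L] is [q]
   times [7 * n]. *)
have [q nq'] : exists q, (n * q = 840)%N.
  have : (n \in [:: 1; 2; 3; 4; 5; 6; 7; 8])%N by rewrite !inE; lia.
  rewrite !inE => /or4P[|||/or4P[|||/orP[]]] => /eqP ->;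
    [exists 840%N|exists 420%N|exists 280%N|exists 210%N
    |exists 168%N|exists 140%N|exists 120%N|exists 105%N]; lia.
have bounds x : x + P%:~R - 1 < iter L F x < x + P%:~R + 2.
  have [Gp Gm _] := is_lift_iter L hF; move: Gp Gm; rewrite /P.
  move: (iter L F) => G Gp Gm.
  have /andP[f1 f2] := floor_itv (G 0); rewrite rmorphD/= in f2.
  have /andP[g1 g2] := floor_itv x.
  have a1 : G (Num.floor x)%:~R <= G x by rewrite homo_lt_mono_le.
  have a2 : G x < G (Num.floor x + 1)%:~R by rewrite Gm.
  have e1 := periodicz Gp 0 (Num.floor x); have e2 := periodicz Gp 0 (Num.floor x + 1).
  rewrite !add0r in e1 e2; rewrite rmorphD/= in e2 g2 a2.
  by apply/andP; split; lra.
have [Gp Gm _] := is_lift_iter (7 * n) hF.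
have e7 x : iter L F x = iter q (iter (7 * n) F) x.
  by rewrite -iterM; congr (iter _ F x); lia.
(* A displacement of at most [7 * m - 1], or at least [7 * m + 1], at one point would repeat under
   [q] iterations and violate [bounds]. *)
exists n, m; split=> // x; apply/andP; split; rewrite ltNge; apply/negP => h.
  have := @iter_le _ x (7 * m - 1) q Gm Gp; rewrite -e7.
  have -> : x + (7 * m - 1)%:~R = x - 1 + (7 * m)%:~R by rewrite rmorphB/=; ring.
  rewrite -lerBlDr => /(_ h) b1; have /andP[b2 _] := bounds x.
  have : (P - 1)%:~R < (q%:Z * (7 * m - 1))%:~R :> R by rewrite rmorphB/=; lra.
  by rewrite ltr_int ltNge (rotation_arith nq' eL _ h1 h2).1// n0.
have := @iter_ge _ x (7 * m + 1) q Gm Gp; rewrite -e7.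
have -> : x + (7 * m + 1)%:~R = x + 1 + (7 * m)%:~R by rewrite rmorphD/=; ring.
rewrite -lerBrDr => /(_ h) b1; have /andP[_ b2] := bounds x.
have : (q%:Z * (7 * m + 1))%:~R < (P + 2)%:~R :> R.
  by rewrite [(P + 2)%:~R]rmorphD/=; lra.
by rewrite ltr_int ltNge (rotation_arith nq' eL _ h1 h2).2// n0.
Qed.

Lemma slow_power f : thompsonT f -> infinite_order f -> exists n g B z,
  [/\ g = (f ^+ n)%g \/ g = (f ^- n)%g, is_lift B g, dyadic z & z < B z /\ iter 7 B z < z + 1].
Proof.
move=> Tf of'; have [F [hF _]] := is_lift_of_thompsonT Tf.
have [n [m [n0 hn]]] := small_rotation hF.
have Tn := thompsonTX n Tf.
(* Removing the integer part [m] gives a lift of the power whose seventh iterate moves every point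
   by less than 1. *)
pose B x := iter n F x + (- m)%:~R.
have hB : is_lift B (f ^+ n)%g by apply: is_lift_shift; exact: is_lift_iter.
have [Fnp _ _] := is_lift_iter n hF.
have B7 x : x - 1 < iter 7 B x < x + 1.
  have Bj j : iter j B x = iter j (iter n F) x + (- (j%:Z * m))%:~R.
    elim: j => [|j ih]; first by rewrite mul0r addr0.
    rewrite !iterS ih /B periodicz// -addrA -rmorphD/=; congr (_ + _%:~R).
    by lia.
  by rewrite Bj -iterM rmorphN; exact: hn.
have [z dz nz] := moved_dyadic Tn (of' n n0).
have nBz : B z <> z by move=> e; apply: nz; rewrite (is_lift_tc _ hB) e.
have [zB|Bz] : z < B z \/ B z < z by apply/orP; rewrite -neq_lt eq_sym; apply/eqP.
  exists n, (f ^+ n)%g, B, z; split=> //; first by left.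
  by split=> //; have /andP[] := B7 z.
(* If [B] moves [z] backwards, the inverse power moves it forwards, with the same bound on seven
   iterations. *)
have [G [hG BK GK]] := is_lift_inv Tn hB.
exists n, (f ^- n)%g, G, z; split=> //; first by right.
split; first by rewrite -(is_lift_mono hB) GK.
have e7 x : iter 7 B (iter 7 G x) = x by rewrite /= !GK.
by have /andP[+ _] := B7 (iter 7 G z); rewrite e7; lra.
Qed.

End Dynamics.

(** * Choice of the conjugator *)

Lemma generated_subgroup (G : groupType) (A : set G) : is_subgroup (generated A).
Proof.
split=> [K [[K1 _ _] _] //|x y Gx Gy K KA|x Gx K KA].
- by have [[_ KM _] _] := KA; apply: KM; [exact: Gx|exact: Gy].
- by have [[_ _ KV] _] := KA; apply: KV; exact: Gx.
Qed.

Lemma sub_generated (G : groupType) (A : set G) : A `<=` generated A.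
Proof. by move=> x Ax K [_]; exact. Qed.

Lemma generated_sub (G : groupType) (A K : set G) : is_subgroup K -> A `<=` K ->
  generated A `<=` K.
Proof. by move=> gK AK x; apply. Qed.

Section Realization.
Variable R : realType.
Implicit Types (F G : R -> R) (a b c d e x y z : R) (k m : int) (n : nat).
Implicit Types (f g h : homeo (circle R)).

Lemma resplice F G f g a b : thompsonT f -> thompsonT g -> is_lift F f -> is_lift G g ->
  dyadic a -> dyadic b -> a < b -> b < a + 1 -> F a = G a -> F b = G b ->
  exists h H, [/\ thompsonT h, is_lift H h, forall x, a <= x <= b -> H x = F x,
    forall x, b <= x <= a + 1 -> H x = G x & forall x, b - 1 <= x <= a -> H x = G x].
Proof.
move=> Tf Tg hF hG da db ab ba Fa Fb.
have [h [H [Th hH e1 e2]]] := splice Tf Tg hF hG da db ab ba Fa Fb.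
exists h, H; split=> // x /andP[x0 x1].
have [Hp _ _] := hH; have [Gp _ _] := hG.
by apply: (@addIr _ 1); rewrite -Hp -Gp e2//; apply/andP; split; lra.
Qed.

(** Order bookkeeping for [realize]: with [[s2, t2]] and [[s3, t3]] the arcs of modification, it
    places the other points in a period outside these arcs, where the old lift is retained. *)
Lemma slots_order z0 s1 t1 s2 t2 s3 t3 z3 : z0 < s1 -> s1 < t1 -> t1 < s2 ->
  s2 < t2 -> t2 < s3 -> s3 < t3 -> t3 < z3 -> z3 < z0 + 1 ->
  [/\ t2 < s2 + 1, t3 < s3 + 1, t2 <= s3 <= s2 + 1 /\ t2 <= t3 <= s2 + 1,
    t3 <= z3 <= s3 + 1 /\ t2 <= z3 <= s2 + 1 &
    (forall y, z0 <= y <= t1 -> t3 - 1 <= y <= s3 /\ t2 - 1 <= y <= s2) /\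
    (forall y, s2 <= y <= t2 -> t3 - 1 <= y <= s3)].
Proof.
move=> h1 h2 h3 h4 h5 h6 h7 h8; split; do ?[lra|split; lra].
by split=> y /andP[y0 y1]; [split|]; apply/andP; split; lra.
Qed.

(* Since F s = A1 p and F (B s) = A2 (G1 p), the product A1 b^f A2^-1 acts on
   [x, e] as G1; likewise A2 b^f A3^-1 acts as G2. *)
Lemma realize (b a1 a2 a3 g1 g2 : homeo (circle R)) (B A1 A2 A3 G1 G2 : R -> R) z0 x e :
  thompsonT b -> thompsonT a1 -> thompsonT a2 -> thompsonT a3 ->
  thompsonT g1 -> thompsonT g2 ->
  is_lift B b -> is_lift A1 a1 -> is_lift A2 a2 -> is_lift A3 a3 ->
  is_lift G1 g1 -> is_lift G2 g2 ->
  dyadic z0 -> dyadic x -> dyadic e -> x < e ->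
  e < A1 x -> A1 e < A2 x -> A2 e < A3 x -> A3 e < x + 1 ->
  G1 x = x -> G1 e = e -> G2 x = x -> G2 e = e ->
  z0 < B z0 -> iter 3 B z0 < z0 + 1 ->
  exists f F, [/\ thompsonT f, is_lift F f, F z0 = e /\ F (iter 3 B z0) = x + 1,
    forall p, x <= p <= e -> exists2 s, F s = A1 p & F (B s) = A2 (G1 p) &
    forall p, x <= p <= e -> exists2 s, F s = A2 p & F (B s) = A3 (G2 p)].
Proof.
move=> Tb Ta1 Ta2 Ta3 Tg1 Tg2 hB hA1 hA2 hA3 hG1 hG2 dz0 dx de xe.
move=> eA1 A12 A23 A31 G1x G1e G2x G2e z0B B3.
have BW := is_lift_monoW hB; have Bm := is_lift_mono hB.
have [B1 _ _] := hB.
(* Any dyadic subarc inside [(z0, B z0)] would do; it and its first two images under [B] are the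
   three slots. *)
pose s1 := z0 + (B z0 - z0) / 4; pose s1' := z0 + (B z0 - z0) / 2.
have z0s1 : z0 < s1 by rewrite /s1; lra.
have s1s1' : s1 < s1' by rewrite /s1 /s1'; lra.
have s1z1 : s1' < B z0 by rewrite /s1'; lra.
have dB y : dyadic y -> dyadic (B y) by move=> dy; apply/(is_lift_dyadic _ Tb hB).
have dA y A f : thompsonT f -> is_lift A f -> dyadic y -> dyadic (A y).
  by move=> Tf hA dy; apply/(is_lift_dyadic _ Tf hA).
have dA1 y : dyadic y -> dyadic (A1 y) by exact: dA Ta1 hA1.
have dA2 y : dyadic y -> dyadic (A2 y) by exact: dA Ta2 hA2.
have dA3 y : dyadic y -> dyadic (A3 y) by exact: dA Ta3 hA3.
have dx1 : dyadic (x + 1) by apply: dyadicD => //; exact: dyadic1.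
have dd : dyadic (B z0 - z0) by apply: dyadicB => //; exact: dB.
have ds1' : dyadic s1' by apply: dyadicD => //; exact: dyadic_half.
have ds1 : dyadic s1.
  rewrite /s1 (_ : _ / 4 = (B z0 - z0) / 2 / 2); last by field.
  by apply: dyadicD => //; do 2!apply: dyadic_half.
clearbody s1 s1'.
have z1s2 : B z0 < B s1 by rewrite Bm.
have s2s2' : B s1 < B s1' by rewrite Bm.
have s2z2 : B s1' < B (B z0) by rewrite Bm.
have z2s3 : B (B z0) < B (B s1) by rewrite !Bm.
have s3s3' : B (B s1) < B (B s1') by rewrite !Bm.
have s3z3 : B (B s1') < B (B (B z0)) by rewrite !Bm.
have [ord1 ord2 [ord3 ord3'] [ord4 ord4'] [ord5 ord6]] :=
  slots_order z0s1 s1s1' (lt_trans s1z1 z1s2) s2s2' (lt_trans s2z2 z2s3) s3s3' s3z3 B3.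
have Ai A f : is_lift A f -> A x < A e by move=> hA; rewrite (is_lift_mono hA).
have A1xe := Ai _ _ hA1; have A2xe := Ai _ _ hA2; have A3xe := Ai _ _ hA3.
(* A first approximation with the right end points only: the slots go onto the translates of
   [[x, e]], and [[z0, B^3 z0]] onto the closed complement [[e, x + 1]]. *)
have [||||g [F0 [Tg hF0 F0z0 [E1 E1' E2 E2' E3 E3' E4]]]] := @thompsonT_transitive R
  [:: s1; s1'; B s1; B s1'; B (B s1); B (B s1'); B (B (B z0))]
  [:: A1 x; A1 e; A2 x; A2 e; A3 x; A3 e; x + 1] z0 e erefl dz0 de.
- move=> y; rewrite !inE => hy.
  by repeat (case/orP: hy => [/eqP ->|hy]; first by do ?apply/dB);
    move/eqP: hy => ->; do ?apply/dB.
- move=> y; rewrite !inE => hy.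
  by repeat (case/orP: hy => [/eqP ->|hy]; first by [exact/dA1|exact/dA2|exact/dA3]);
    move/eqP: hy => ->.
- by rewrite /= z0s1 s1s1' (lt_trans s1z1) // s2s2' (lt_trans s2z2)// s3s3' s3z3 B3.
- by rewrite /= eA1 A1xe A12 A2xe A23 A3xe A31 ltrD2r xe.
have [Bi [hBi BK BiK]] := is_lift_inv Tb hB.
have [A1i [hA1i A1K A1iK]] := is_lift_inv Ta1 hA1.
have [A2i [hA2i A2K A2iK]] := is_lift_inv Ta2 hA2.
have z3 : B (B (B z0)) < z0 + 1 by exact: B3.
(* On the second slot the values are forced by those on the first: pull back by [B], map by [F0],
   return to [[x, e]] by [A1], apply [G1] and move on by [A2]. *)
have hP2 := is_lift_comp hBi (is_lift_comp hF0 (is_lift_comp hA1i (is_lift_comp hG1 hA2))).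
have [||||h [F1 [Th hF1 F1a F1b F1c]]] := resplice _ Tg hP2 hF0 (dB _ ds1) (dB _ ds1') s2s2'.
- by do ?apply: thompsonTM => //; exact: thompsonTV.
- by [].
- by rewrite /= BK E1 A1K G1x E2.
- by rewrite /= BK E1' A1K G1e E2'.
have F1s2 : F1 (B s1) = A2 x by rewrite F1a ?lexx ?(ltW s2s2')//= BK E1 A1K G1x.
have F1s2' : F1 (B s1') = A2 e by rewrite F1a ?lexx ?(ltW s2s2')//= BK E1' A1K G1e.
have F1s3 : F1 (B (B s1)) = A3 x by rewrite F1b ?E3.
have F1s3' : F1 (B (B s1')) = A3 e by rewrite F1b ?E3'.
(* The third slot is determined in the same way by the second, so it must use the already corrected
   lift [F1]. *)
have hP3 := is_lift_comp hBi (is_lift_comp hF1 (is_lift_comp hA2i (is_lift_comp hG2 hA3))).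
have [||||f [F [Tf hF Fa Fb Fc]]] := resplice _ Th hP3 hF1 (dB _ (dB _ ds1))
  (dB _ (dB _ ds1')) s3s3'.
- by do ?apply: thompsonTM => //; exact: thompsonTV.
- by [].
- by rewrite /= BK F1s2 A2K G2x F1s3.
- by rewrite /= BK F1s2' A2K G2e F1s3'.
exists f, F; split=> //.
- have z0z0 : z0 <= z0 <= s1' by rewrite lexx (ltW (lt_trans z0s1 s1s1')).
  have [c1 c2] := ord5 _ z0z0; split; first by rewrite Fc ?F1c ?F0z0.
  by rewrite /= Fb ?F1b ?E4.
- move=> p /andP[xp pe]; have [s Fs] := is_lift_surj (A1 p) Tg hF0.
  have s10 : s1 <= s by rewrite -(is_lift_monoW hF0) E1 Fs (is_lift_monoW hA1).
  have s11 : s <= s1' by rewrite -(is_lift_monoW hF0) E1' Fs (is_lift_monoW hA1).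
  have B10 : B s1 <= B s by rewrite BW.
  have B11 : B s <= B s1' by rewrite BW.
  have hs : z0 <= s <= s1' by rewrite s11 (le_trans (ltW z0s1)).
  have [c1 c2] := ord5 _ hs; exists s; first by rewrite Fc ?F1c.
  have hBs : B s1 <= B s <= B s1' by rewrite B10.
  by rewrite (Fc _ (ord6 _ hBs)) F1a//= BK Fs A1K.
- move=> p /andP[xp pe]; have [s Fs] := is_lift_surj (A2 p) Th hF1.
  have s10 : B s1 <= s by rewrite -(is_lift_monoW hF1) F1s2 Fs (is_lift_monoW hA2).
  have s11 : s <= B s1' by rewrite -(is_lift_monoW hF1) F1s2' Fs (is_lift_monoW hA2).
  have B10 : B (B s1) <= B s by rewrite BW.
  have B11 : B s <= B (B s1') by rewrite BW.
  have hs : B s1 <= s <= B s1' by rewrite s10.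
  exists s; first by rewrite (Fc _ (ord6 _ hs)).
  by rewrite Fa ?B10//= BK Fs A2K.
Qed.

Lemma cell_between_translates x y1 y2 y3 f : thompsonT f -> dyadic x ->
  translate_of f x y1 -> translate_of f x y2 -> translate_of f x y3 ->
  y1 < y2 -> y2 < y3 -> exists u f1 f2 f3 A1 A2 A3,
  [/\ dcell u /\ u.1 = x,
    (exists n, f1 = (f ^+ n)%g) /\ is_lift A1 f1,
    (exists n, f2 = (f ^+ n)%g) /\ is_lift A2 f2,
    (exists n, f3 = (f ^+ n)%g) /\ is_lift A3 f3 &
    [/\ x + u.2 < A1 x, A1 (x + u.2) < A2 x, A2 (x + u.2) < A3 x
      & A3 (x + u.2) < x + 1]].
Proof.
move=> Tf dx [n1 [A1 [hA1 e1 /andP[y10 y11]]]] [n2 [A2 [hA2 e2 /andP[y20 y21]]]]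
  [n3 [A3 [hA3 e3 /andP[y30 y31]]]] y12 y23.
have h1 : A1 x < A2 x by rewrite e1 e2.
have h2 : A2 x < A3 x by rewrite e2 e3.
have h3 : A3 x < x + 1 by rewrite e3.
rewrite -e1 in y10.
have [d1 d10 hd1] := is_lift_right (thompsonTX n1 Tf) hA1 h1 y10.
have [d2 d20 hd2] := is_lift_right (thompsonTX n2 Tf) hA2 h2 y10.
have [d3 d30 hd3] := is_lift_right (thompsonTX n3 Tf) hA3 h3 y10.
have [k1 hk1] := small_pow2 d10; have [k2 hk2] := small_pow2 d20.
have [k3 hk3] := small_pow2 d30.
(* The exponent exceeds all of [k1], [k2], [k3], so the length [l] is below the three margins at
   once. *)
pose k := (k1 + k2 + k3)%N; pose l : R := 2 ^ (- k.+1%:Z).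
have lk j : (j <= k)%N -> l < 2 ^- j.
  move=> jk; rewrite /l -invr_expz ltf_pV2 ?posrE ?exprz_gt0 ?exprn_gt0//.
  by rewrite -[2 ^ _]/(2 ^+ k.+1) ltr_eXn2l ?ltr1n.
have l0 : 0 < l by exact: pow2_gt0.
have l1 : l < 2 ^- k1 by apply: lk; rewrite /k -addnA leq_addr.
have l2 : l < 2 ^- k2 by apply: lk; rewrite /k addnAC leq_addl.
have l3 : l < 2 ^- k3 by apply: lk; rewrite /k leq_addl.
have [q11 q12] : A1 (x + l) < A2 x /\ x + l < A1 x by apply: hd1; apply/andP; split; lra.
have [q21 _] : A2 (x + l) < A3 x /\ x + l < A1 x by apply: hd2; apply/andP; split; lra.
have [q31 _] : A3 (x + l) < x + 1 /\ x + l < A1 x by apply: hd3; apply/andP; split; lra.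
exists (x, l), (f ^+ n1)%g, (f ^+ n2)%g, (f ^+ n3)%g, A1, A2, A3; split=> //.
- by split=> //; split=> //; exists k.
- by split=> //; exists n1.
- by split=> //; exists n2.
- by split=> //; exists n3.
Qed.

End Realization.

(** * Verification of the criterion for the conjugator *)

Theorem proposition3p1 (R : realType) (alpha zeta : homeo (circle R))
    (halpha : thompsonT alpha) (hzeta : thompsonT zeta)
    (oalpha : infinite_order alpha) (ozeta : infinite_order zeta) :
  exists gamma : homeo (circle R),
    thompsonT gamma /\
    @thompsonT R = generated [set alpha; (zeta ^ gamma)%g].
Proof.
have [x [y1 [y2 [y3 [dx t1 t2 t3 [y12 y23]]]]]] := three_translates halpha oalpha.
have [u [a1 [a2 [a3 [A1 [A2 [A3 [[du ux] [p1 hA1] [p2 hA2] [p3 hA3] [q1 q2 q3 q4]]]]]]]]] :=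
  cell_between_translates halpha dx t1 t2 t3 y12 y23.
have su := dcell_small du; have /andP[u0 u1] := su.
have [_ du2] := dcell_dyadic du.
have pow a : (exists n, a = (alpha ^+ n)%g) -> thompsonT a.
  by move=> [n ->]; exact: thompsonTX.
have [n [b [B [z0 [eb hB dz0 [z0B B7]]]]]] := slow_power hzeta ozeta.
have Tb : thompsonT b by case: eb => ->; [|apply: thompsonTV]; exact: thompsonTX.
have [g1 Tg1 gg1] := exists_gen du; have [g2 Tg2 gg2] := exists_gen (dcell_rc du).
have [_ _ _ sg1] := gg1; have [_ _ _ /(supp_rc su) sg2] := gg2.
have [G1 [hG1 G1x G1e]] := supp_lift su Tg1 sg1.
have [G2 [hG2 G2x G2e]] := supp_lift su Tg2 sg2.
rewrite ux in G1x G1e G2x G2e.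
have Bm := is_lift_mono hB.
have B3 : iter 3 B z0 < z0 + 1.
  have BB y : z0 < y -> z0 < B y by move=> zy; apply: (lt_trans z0B); rewrite Bm.
  apply: lt_trans B7; rewrite /= !Bm; exact: (BB _ (BB _ (BB _ z0B))).
have due : dyadic (x + u.2) by exact: dyadicD.
have xe : x < x + u.2 by rewrite ltrDl.
have [gamma [F [Tg hF [Fz0 Fz3] W1 W2]]] := realize Tb (pow _ p1) (pow _ p2) (pow _ p3)
  Tg1 Tg2 hB hA1 hA2 hA3 hG1 hG2 dz0 dx due xe q1 q2 q3 q4 G1x G1e G2x G2e z0B B3.
exists gamma; split=> //.
pose H := generated [set alpha; (zeta ^ gamma)%g].
have gH : is_subgroup H by exact: generated_subgroup.
have [H1 HM HV] := gH.
have HT : H `<=` @thompsonT R.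
  apply: generated_sub; first exact: thompsonT_subgroup.
  by move=> f [->|->] //; exact: thompsonTJ.
have HX f m : H f -> H (f ^+ m)%g.
  by move=> Hf; elim: m => [//|m ih]; rewrite expgS; exact: HM.
have Ha a : (exists n, a = (alpha ^+ n)%g) -> H a.
  by move=> [m ->]; apply: HX; apply: sub_generated; left.
have Hb : H (b ^ gamma)%g.
  have Hz : H (zeta ^ gamma)%g by apply: sub_generated; right.
  case: eb => ->; first by rewrite conjXg; exact: HX.
  by rewrite conjVg conjXg; apply: HV; exact: HX.
have [C [hC FK CK]] := is_lift_inv Tg hF.
have hBg : is_lift ((F \o B) \o C) (b ^ gamma)%g.
  exact: is_lift_comp hC (is_lift_comp hB hF).
(* In terms of the conjugated power, the slot identities say that [c1 * b ^ gamma * c2^-1] restricts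
   to [g] on the cell [u]. *)
have act (c1 c2 g : homeo (circle R)) (D1 D2 G : R -> R) :
    H c1 -> H c2 -> is_lift D1 c1 -> is_lift D2 c2 ->
    is_lift G g ->
    (forall p, x <= p <= x + u.2 -> exists2 s, F s = D1 p & F (B s) = D2 (G p)) ->
    exists2 h, H h & forall p, incell u p -> h p = g p.
  move=> H1' H2' hD1 hD2 hG W; exists (c1 * b ^ gamma * c2^-1)%g.
    exact: (HM _ _ (HM _ _ H1' Hb) (HV _ H2')).
  move=> _ [s /andP[s0 s1] ->].
  have sp : x <= u.1 + u.2 * s <= x + u.2.
    by rewrite ux lerDl lerD2l ler_piMr ?(ltW u0)// mulr_ge0// ltW.
  have [r r1 r2] := W _ sp.
  rewrite (is_lift_tc _ hG) homeoME [(c1 * _)%g _]homeoME (is_lift_tc _ hD1).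
  rewrite (is_lift_tc _ hBg) /= -r1 FK r2 -(is_lift_tc _ hD2).
  exact: homeo_invK.
have Hext f : thompsonT f -> supp f u ->
    exists2 h, H h & forall p, incell u p -> h p = f p.
  (* The elements supported in [u] that extend to [H] form a subgroup, as they preserve [u]; it
     contains both generators of F on [u]. *)
  pose P := [set f | supp f u /\ exists2 h, H h & forall p, incell u p -> h p = f p].
  move=> Tf sf; suff : P f by case.
  apply: (@supp_generated _ P u) => //.
  - split.
    + by split; [exact: supp1|exists 1%g].
    + move=> f1 f2 [s1 [h1 Hh1 e1]] [s2 [h2 Hh2 e2]]; split; first exact: suppM.
      exists (h1 * h2)%g; first exact: HM.
      by move=> p up; rewrite !homeoME e1// e2//; exact: supp_incell.
    + move=> f1 [s1 [h1 Hh1 e1]]; split; first exact: suppV.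
      exists (h1^-1)%g; first exact: HV.
      move=> p up; apply: (@homeo_inj _ h1); rewrite homeo_Kinv e1 ?homeo_Kinv//.
      by apply: supp_incell up; exact: suppV.
  - exists g1 => //; split=> //.
    exact: act (Ha _ p1) (Ha _ p2) hA1 hA2 hG1 W1.
  - exists g2 => //; split=> //.
    exact: act (Ha _ p2) (Ha _ p3) hA2 hA3 hG2 W2.
(* The fourth power moves [B^3 z0] to [B^7 z0], still before [z0 + 1], and [z0] to [B^4 z0], beyond
   [B^3 z0]. Through [F] these give the two inequalities of the criterion after a shift by -1. *)
have hT := is_lift_shift (-1) (is_lift_iter 4 hBg).
have T4 y : iter 4 ((F \o B) \o C) (F y) = F (iter 4 B y) by rewrite /= !FK.
have [Fp Fm _] := hF.
have [B1 _ _] := hB.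
apply/seteqP; split; last exact: HT.
move=> f Tf; apply: (generation_criterion gH HT du Hext (HX _ 4%N Hb) hT) => //.
- rewrite ux -Fz0 T4 rmorphN /= ltrBrDr.
  rewrite -[X in X < _]/(x + 1) -Fz3; apply: Fm.
  by rewrite /= !Bm.
- have e1 : F (iter 3 B z0) = u.1 + 1 by rewrite Fz3 ux.
  rewrite -e1 T4 rmorphN /= ltrBlDr ux -Fz0 -Fp; exact: Fm.
Qed.
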